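(* Let $p$ be an odd prime and $\phi=(x-\gamma)^2-c_1$ with $\gamma,c_1\in\overline{\mathbb{F}}_p[t]$, non-isotrivial (i.e. $\deg(\gamma+c_1)>0$), non-square (i.e. $c_1\neq0$), with dynamical inseparability degree $e$. Suppose $c_1+\gamma\pm\sqrt{c_1}\neq 0$ (for both signs), and let $n\geq 3$ satisfy $\deg(\gamma+c_1)2^{n-3}>h(\phi)$. For each $m\ge1$ write $c_m=d_my_m^2$ with $d_m,y_m\in\overline{\mathbb{F}}_p[t]$ and $d_m$ squarefree. Then $$h(c_{n-1})\leq A\,h(d_n)+B,$$ where $A=8p^e$ and $B=8p^e\big(h(d_1)+4+4h(\operatorname{rad}c_1)+4h(\operatorname{rad}c_2)\big)+4h(\gamma)+8h(c_1)$.
   Context: The adjusted post-critical orbit is $c_1=-\phi(\gamma)$, $c_n=\phi^{(n)}(\gamma)$ for $n\geq2$. For $f\in\overline{\mathbb{F}}_p[t]$, $h(f)=\deg f$, $h(\phi)=\max\{h(\gamma),h(c_1)\}$, and $\operatorname{rad}f$ is the product of the distinct irreducible factors of $f$. $\sqrt{c_1}$ denotes a fixed square root of $c_1$. The dynamical inseparability degree $e$ of $\phi$ is: $\max\{i: c_2/c_1\in\overline{\mathbb{F}}_p(t)^{p^i}\}$ if $c_1\notin\overline{\mathbb{F}}_p[t]^2$; $\max\{i:\frac{\gamma}{\sqrt{c_1}}+\sqrt{c_1}\in\overline{\mathbb{F}}_p(t)^{p^i}\}$ if $c_1\in\overline{\mathbb{F}}_p[t]^2$ and $\frac{\gamma}{\sqrt{c_1}}+\sqrt{c_1}\notin\overline{\mathbb{F}}_p$;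 $\max\{i:c_1\in\overline{\mathbb{F}}_p(t)^{p^i}\}$ if $c_1\in\overline{\mathbb{F}}_p[t]^2$ and $\frac{\gamma}{\sqrt{c_1}}+\sqrt{c_1}\in\overline{\mathbb{F}}_p$. *)

(* Defs.v *)
From HB Require Import structures.
From mathcomp Require Import all_boot all_order all_algebra all_field.

Set Implicit Arguments.
Unset Strict Implicit.
Unset Printing Implicit Defensive.

Import GRing.Theory.
Local Open Scope ring_scope.

(* The degree, with the convention height 0 = 0. *)
Definition height (F : fieldType) (f : {poly F}) : nat := (size f).-1.

Definition squarefree_poly (F : fieldType) (f : {poly F}) : Prop :=
  forall q : {poly F}, q ^+ 2 %| f -> size q = 1%N.

Definition square_poly (F : fieldType) (f : {poly F}) : Prop :=
  exists g : {poly F}, f = g ^+ 2.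

(* Irreducible factors are taken monic, i.e. one per associate class;
   no r satisfies is_rad 0 r. *)
Definition is_rad (F : fieldType) (f r : {poly F}) : Prop :=
  exists s : seq {poly F},
    [/\ uniq s,
        forall q, q \in s <-> [/\ q \is monic, irreducible_poly q & q %| f]
      & r = \prod_(q <- s) q].

Definition phi (F : fieldType) (gamma c1 : {poly F}) : {poly {poly F}} :=
  ('X - gamma%:P) ^+ 2 - c1%:P.

(* Indexed from 1: the value at 0 is junk. *)
Definition postcrit (F : fieldType) (gamma c1 : {poly F}) (n : nat) : {poly F} :=
  if n == 1%N then - (phi gamma c1).[gamma]
  else iter n (horner (phi gamma c1)) gamma.

Lemma postcrit1 (F : fieldType) (gamma c1 : {poly F}) :
  postcrit gamma c1 1 = c1.
Proof. by rewrite /postcrit /phi /= !hornerE subrr expr0n sub0r opprK. Qed.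

Definition height_phi (F : fieldType) (gamma c1 : {poly F}) : nat :=
  maxn (height gamma) (height c1).

Definition is_max (P : nat -> Prop) (e : nat) : Prop :=
  P e /\ forall i, P i -> (i <= e)%N.

(* L is an extension of F(t) through iota; it is needed because a square root
   of c1 need not lie in F(t). *)
Section Extension.

Variables (F L : fieldType) (iota : {rmorphism {fraction {poly F}} -> L}).

Definition embed (f : {poly F}) : L := iota (tofrac f).

(* x lies in F(t)^(p^i). *)
Definition in_ppower (p i : nat) (x : L) : Prop :=
  exists z : {fraction {poly F}}, x = iota z ^+ (p ^ i).

Definition is_constant (x : L) : Prop := exists a : F, x = embed a%:P.

(* s is a square root of c1 in L. *)
Variant dyn_insep_degree (p : nat) (gamma c1 : {poly F}) (s : L) (e : nat)
    : Prop :=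
| DynInsepNonsquare of
    ~ square_poly c1
  & is_max (fun i =>
      in_ppower p i (embed (postcrit gamma c1 2) / embed c1)) e
| DynInsepSquare of
    square_poly c1
  & ~ is_constant (embed gamma / s + s)
  & is_max (fun i => in_ppower p i (embed gamma / s + s)) e
| DynInsepConstant of
    square_poly c1
  & is_constant (embed gamma / s + s)
  & is_max (fun i => in_ppower p i (embed c1)) e.

End Extension.

(* Main.v *)
(* Put a = gamma + c1, x = c_(n-2) - gamma (x = - a if n = 3, as the orbit is not
   adjusted there) and v = x^2 - a = c_(n-1) - gamma, so
   that v^2 - c1 = d y^2 with d = d_n, and let b = a^2 - c1 = c_2. The elements
   eta = v + y sqrt d and beta = - a + sqrt b both have norm c1, and
   2 eta x^2 = (eta - beta) (eta - beta'), beta' being the conjugate of beta.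
   Hence eps = eta / beta has its zeros and poles at infinity and at the roots of
   c1, while 1 - eps is almost a square. A Mason-type argument (the logarithmic
   derivative of eps vanishes to high order at the zeros of x, and its poles lie
   over the roots of d, b and c1) bounds the height of eps, hence that of v. When
   eps is a p^i-th power it is applied to the p^i-th root, which costs a factor
   p^i; and i <= e, since otherwise a^2 / c1 and v / a would be p^(e+1)-th powers.

   The argument is carried out inside F(t). If b d is a square,
   f = (1 + eps)^2 / (4 eps) lies in F(t) and (eps' / eps)^2 is
   f'^2 / (f (f - 1)). Otherwise one uses the product of the logarithmic
   derivatives of eta / beta and eta / beta', which is a quarter of the difference
   of the expressions f'^2 / (f (f - 1)) at f = v^2 / c1 and f = a^2 / c1. *)

Require Import Defs.
From HB Require Import structures.
From mathcomp Require Import all_boot all_order all_algebra all_field.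
From mathcomp Require Import zify ring.
From Stdlib Require Import Classical.

Set Implicit Arguments.
Unset Strict Implicit.
Unset Printing Implicit Defensive.

Import Order.TTheory GRing.Theory Num.Theory.
Local Open Scope ring_scope.

(** * Heights of polynomials *)

Section Height.

Variable F : fieldType.
Implicit Types p q : {poly F}.

Lemma heightM p q : p != 0 -> q != 0 ->
  height (p * q) = (height p + height q)%N.
Proof.
move=> p0 q0; rewrite /height size_mul //.
have sp : (0 < size p)%N by rewrite size_poly_gt0.
have sq : (0 < size q)%N by rewrite size_poly_gt0.
by case: (size p) (size q) sp sq => // m [//|k] _ _; rewrite addnS addSn.
Qed.

Lemma heightX p k : height (p ^+ k) = (k * height p)%N.
Proof. by rewrite /height size_exp mulnC. Qed.

Lemma heightN p : height (- p) = height p.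
Proof. by rewrite /height size_polyN. Qed.

Lemma heightD_le p q n :
  (height p <= n)%N -> (height q <= n)%N -> (height (p + q) <= n)%N.
Proof.
rewrite /height => hp hq; have h := size_polyD p q.
have gen (u w m : nat) : (u.-1 <= m -> w.-1 <= m -> (maxn u w).-1 <= m)%N by lia.
by apply: leq_trans (gen _ _ _ hp hq); rewrite -!subn1 leq_sub2r.
Qed.

Lemma heightM_le p q : (height (p * q) <= height p + height q)%N.
Proof.
have [->|p0] := eqVneq p 0; first by rewrite mul0r /height size_poly0.
have [->|q0] := eqVneq q 0; first by rewrite mulr0 /height size_poly0.
by rewrite heightM.
Qed.

Lemma heightD_dominant p q :
  (height q < height p)%N -> height (p + q) = height p.
Proof. by rewrite /height => h; rewrite size_polyDl //; lia. Qed.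

End Height.

(** * Norm and discriminant identities for eps *)

Section OrbitIdentities.

Variables (R : comNzRingType) (a c v d y h : R).
Hypotheses (hE : h ^+ 2 = (a ^+ 2 - c) * d) (yE : d * y ^+ 2 = v ^+ 2 - c).

(** It holds as (c + a v)^2 - (a^2 - c)(v^2 - c) = c (v + a)^2. With h^2 = b d and f = (1 + eps)^2 /
    (4 eps), the factors are 2 c (1 - f) for the two choices of beta; when v + a = x^2 the product
    is c x^4, hence 1 - f is almost a fourth power. *)
Lemma trace_conj_mul :
  (c + a * v + y * h) * (c + a * v - y * h) = c * (v + a) ^+ 2.
Proof.
have E : y ^+ 2 * h ^+ 2 = (a ^+ 2 - c) * (v ^+ 2 - c) by rewrite hE -yE; ring.
have -> : (c + a * v + y * h) * (c + a * v - y * h)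
    = (c + a * v) ^+ 2 - y ^+ 2 * h ^+ 2 by ring.
by rewrite E; ring.
Qed.

(** This is f (1 - f) = - ((eps - 1 / eps) / 4)^2 cleared of denominators, the factor d making the
    right side a square up to sign. It gives the parity of the orders of f (1 - f) away from d and
    c. *)
Lemma trace_disc :
  (c - a * v - y * h) * (c + a * v + y * h) * d = - (v * h + a * y * d) ^+ 2.
Proof.
have E : y ^+ 2 * h ^+ 2 = (a ^+ 2 - c) * (v ^+ 2 - c) by rewrite hE -yE; ring.
have -> : (c - a * v - y * h) * (c + a * v + y * h) * d =
    (c ^+ 2 - a ^+ 2 * v ^+ 2 - 2%:R * a * v * y * h - y ^+ 2 * h ^+ 2) * d.
  by ring.
have -> : (v * h + a * y * d) ^+ 2 = v ^+ 2 * h ^+ 2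
    + 2%:R * a * v * y * h * d + a ^+ 2 * d * (d * y ^+ 2) by ring.
by rewrite E hE yE; ring.
Qed.

End OrbitIdentities.

(** * Derivation and places of F(t) *)

Lemma fraction_quotient (R : idomainType) (f : {fraction R}) :
  exists u : R * R, (u.2 != 0) && (f == tofrac u.1 / tofrac u.2).
Proof.
have d0 : tofrac \d_(repr f) != 0 by rewrite tofrac_eq0 denom_ratioP.
exists (\n_(repr f), \d_(repr f)); rewrite /= denom_ratioP /=; apply/eqP/esym.
apply: (mulIf d0); rewrite mulfVK // -[in RHS](reprK f).
unlock tofrac; rewrite -[RHS]FracField.pi_mul; apply/eqmodP.
rewrite /= FracField.equivfE /FracField.mulf.
by rewrite !numden_Ratio ?mulr1 ?mulf_neq0 ?oner_eq0 ?denom_ratioP // reprK mul1r.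
Qed.

Section RationalFunctions.

(* K with io is a model of the field F(t); keeping it abstract makes field
   arithmetic much faster than in {fraction {poly F}} itself. *)
Variables (F : closedFieldType) (K : fieldType) (io : {rmorphism {poly F} -> K}).
Hypothesis io_inj : injective io.
Hypothesis io_quotient :
  forall f : K, exists u, (u.2 != 0) && (f == io u.1 / io u.2).
Implicit Types (p q : {poly F}) (f g : K).

Definition frac_num f : {poly F} := (xchoose (io_quotient f)).1.
Definition frac_den f : {poly F} := (xchoose (io_quotient f)).2.

Lemma io_eq0 p : (io p == 0) = (p == 0).
Proof. by rewrite -(rmorph0 io) (inj_eq io_inj). Qed.

Lemma frac_den_neq0 f : frac_den f != 0.
Proof. by have /andP[] := xchooseP (io_quotient f). Qed.

Lemma frac_numden f : f = io (frac_num f) / io (frac_den f).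
Proof. by have /andP[_ /eqP] := xchooseP (io_quotient f). Qed.

Lemma io_div_eq p q p' q' : q != 0 -> q' != 0 ->
  io p / io q = io p' / io q' -> p * q' = p' * q.
Proof.
move=> q0 q'0 /eqP; rewrite eqr_div ?io_eq0 // -!rmorphM => /eqP.
exact: io_inj.
Qed.

Lemma frac_coprime f :
  exists p q, [/\ q != 0, coprimep p q & f = io p / io q].
Proof.
set p := frac_num f; set q := frac_den f.
have q0 : q != 0 := frac_den_neq0 f.
have g0 : gcdp p q != 0 by rewrite gcdp_eq0 negb_and q0 orbT.
exists (p %/ gcdp p q), (q %/ gcdp p q); split.
- by rewrite dvdp_div_eq0 // dvdp_gcdr.
- by rewrite coprimep_div_gcd // q0 orbT.
rewrite (frac_numden f) -/p -/q.
apply/eqP; rewrite eqr_div ?io_eq0 // ?dvdp_div_eq0 ?dvdp_gcdr //.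
rewrite -!rmorphM -{1}(divpK (dvdp_gcdl p q)).
by rewrite -mulrA [gcdp p q * _]mulrC divpK ?dvdp_gcdr.
Qed.

(** The derivation d/dt, by the quotient rule on one chosen fraction; [fder_div] shows independence
    of the choice. *)
Definition fder f : K :=
  (io (frac_num f)^`() * io (frac_den f) - io (frac_num f) * io (frac_den f)^`())
  / io (frac_den f) ^+ 2.

Lemma fder_div p q : q != 0 ->
  fder (io p / io q) =
  (io p^`() * io q - io p * io q^`()) / io q ^+ 2.
Proof.
move=> q0; set f := io p / io q; rewrite /fder.
set P := frac_num f; set Q := frac_den f.
have Q0 : Q != 0 := frac_den_neq0 f.
have E : P * q = p * Q by apply: io_div_eq => //; rewrite -frac_numden.
have E' : P^`() * q + P * q^`() = p^`() * Q + p * Q^`() by rewrite -!derivM E.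
move: E E' => /(congr1 io) E /(congr1 io).
rewrite !rmorphM in E; rewrite !rmorphD !rmorphM => E'.
apply/eqP; rewrite eqr_div ?expf_neq0 ?io_eq0 // -subr_eq0; apply/eqP.
(* The cross-multiplied difference is a combination of P q = p Q and of its derivative. *)
transitivity (io Q * io q * (io P^`() * io q + io P * io q^`()
                             - (io p^`() * io Q + io p * io Q^`()))
    - (io P * io q - io p * io Q) * (io Q^`() * io q + io Q * io q^`())).
  by ring.
by rewrite E E' !subrr mulr0 mul0r subrr.
Qed.

Lemma fder_io p : fder (io p) = io p^`().
Proof.
rewrite -[io p]divr1 -(rmorph1 io) fder_div ?oner_eq0 //.
by rewrite derivC !rmorph0 mulr0 subr0 !rmorph1 mulr1 expr1n divr1.
Qed.

Lemma fderM f g : fder (f * g) = fder f * g + f * fder g.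
Proof.
rewrite (frac_numden f) (frac_numden g).
move: (frac_num f) (frac_num g) (frac_den_neq0 f) (frac_den_neq0 g).
move: (frac_den f) (frac_den g) => q q' p p' q0 q'0.
rewrite mulf_div -!rmorphM !fder_div ?mulf_neq0 // !derivM !(rmorphM, rmorphD) /=.
by field; rewrite !io_eq0 q0 q'0.
Qed.

Lemma fderD f g : fder (f + g) = fder f + fder g.
Proof.
rewrite (frac_numden f) (frac_numden g).
move: (frac_num f) (frac_num g) (frac_den_neq0 f) (frac_den_neq0 g).
move: (frac_den f) (frac_den g) => q q' p p' q0 q'0.
rewrite addf_div ?io_eq0 // -!rmorphM -rmorphD !fder_div ?mulf_neq0 //.
rewrite !(derivM, derivD) !(rmorphM, rmorphD) /=.
by field; rewrite !io_eq0 q0 q'0.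
Qed.

Lemma fder1 : fder 1 = 0.
Proof. by rewrite -(rmorph1 io) fder_io derivC rmorph0. Qed.

Lemma fder0 : fder 0 = 0.
Proof. by rewrite -(rmorph0 io) fder_io deriv0 rmorph0. Qed.

Lemma fderN f : fder (- f) = - fder f.
Proof.
by apply/eqP; rewrite -addr_eq0 -fderD addNr fder0.
Qed.

Lemma fderB f g : fder (f - g) = fder f - fder g.
Proof. by rewrite fderD fderN. Qed.

(** An order function on nonzero polynomials, with junk at 0; d/dt changes the order by at least
    [kap], which is -1 at a finite point and 1 at infinity. *)
Record place (w : {poly F} -> int) (kap : int) : Prop := Place {
  placeM : forall p q, p != 0 -> q != 0 -> w (p * q) = w p + w q;
  placeD : forall n p q, p != 0 -> q != 0 -> p + q != 0 ->
    n <= w p -> n <= w q -> n <= w (p + q);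
  place_deriv : forall p, p^`() != 0 -> w p + kap <= w p^`() }.

(** * Orders of rational functions at a place *)

Section Valuation.

Variables (w : {poly F} -> int) (kap : int) (wP : place w kap).
Implicit Types (n m : int).

Definition val f : int := w (frac_num f) - w (frac_den f).

(* Reads "ord f >= n" with ord 0 = +oo, whereas val 0 is junk. *)
Definition vge n f := f != 0 -> n <= val f.

Lemma place1 : w 1 = 0.
Proof. have := placeM wP (oner_neq0 {poly F}) (oner_neq0 {poly F}).
by rewrite mulr1 -[LHS]addr0 => /addrI. Qed.

Lemma val_div p q : p != 0 -> q != 0 -> val (io p / io q) = w p - w q.
Proof.
move=> p0 q0; set f := io p / io q; rewrite /val.
have Q0 := frac_den_neq0 f.
have E : frac_num f * q = p * frac_den f.
  by apply: io_div_eq => //; rewrite -frac_numden.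
have P0 : frac_num f != 0.
  apply: contra_neq p0 => P0; apply/eqP; move: E; rewrite P0 mul0r => /esym/eqP.
  by rewrite mulf_eq0 (negPf Q0) orbF.
by have := congr1 w E; rewrite !(placeM wP) //; lia.
Qed.

Lemma val_io p : p != 0 -> val (io p) = w p.
Proof.
move=> p0; rewrite -[io p]divr1 -(rmorph1 io) val_div ?oner_eq0 //.
by rewrite place1 subr0.
Qed.

Lemma frac_nz f : f != 0 ->
  exists p q, [/\ p != 0, q != 0 & f = io p / io q].
Proof.
move=> f0; exists (frac_num f), (frac_den f).
rewrite frac_den_neq0 -frac_numden; split=> //.
apply: contra_neq f0 => P0.
by rewrite (frac_numden f) P0 rmorph0 mul0r.
Qed.

Lemma valM f g : f != 0 -> g != 0 -> val (f * g) = val f + val g.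
Proof.
move=> /frac_nz[p [q [p0 q0 ->]]] /frac_nz[p' [q' [p'0 q'0 ->]]].
by rewrite mulf_div -!rmorphM !val_div ?mulf_neq0 // !(placeM wP) //; lia.
Qed.

Lemma val1 : val 1 = 0.
Proof. by rewrite -(rmorph1 io) val_io ?oner_eq0 // place1. Qed.

Lemma valV f : f != 0 -> val f^-1 = - val f.
Proof.
move=> f0; have := valM f0 (invr_neq0 f0).
by rewrite divff // val1; lia.
Qed.

Lemma valX f k : f != 0 -> val (f ^+ k) = k%:Z * val f.
Proof.
move=> f0; elim: k => [|k IH]; first by rewrite expr0 val1 mul0r.
by rewrite exprS valM ?expf_neq0 // IH; lia.
Qed.

Lemma valN f : val (- f) = val f.
Proof.
have [->|f0] := eqVneq f 0; first by rewrite oppr0.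
have m1 : (-1 : K) != 0 by rewrite oppr_eq0 oner_eq0.
rewrite -mulN1r valM //.
by have := valM m1 m1; rewrite mulrNN mulr1 val1; lia.
Qed.

Lemma vgeD n f g : vge n f -> vge n g -> vge n (f + g).
Proof.
have [->|f0] := eqVneq f 0; first by rewrite add0r.
have [->|g0] := eqVneq g 0; first by rewrite addr0.
move=> /(_ f0) + /(_ g0).
have [p [q [p0 q0 ->]]] := frac_nz f0.
have [p' [q' [p'0 q'0 ->]]] := frac_nz g0.
rewrite /vge addf_div ?io_eq0 // -!rmorphM -rmorphD => + + s0.
have {}s0 : p * q' + p' * q != 0.
  by apply: contraNneq s0 => ->; rewrite rmorph0 mul0r.
rewrite !val_div ?mulf_neq0 // (placeM wP) // => h1 h2.
rewrite lerBrDr.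
by apply: (placeD wP); rewrite ?mulf_neq0 // !(placeM wP) //; lia.
Qed.

Lemma vgeN n f : vge n f -> vge n (- f).
Proof. by rewrite /vge oppr_eq0 valN. Qed.

Lemma vgeB n f g : vge n f -> vge n g -> vge n (f - g).
Proof. by move=> hf hg; apply: vgeD => //; apply: vgeN. Qed.

Lemma vge_mul n m f g : vge n f -> vge m g -> vge (n + m) (f * g).
Proof.
move=> hf hg; rewrite /vge mulf_eq0 negb_or => /andP[f0 g0].
by rewrite valM //; move: (hf f0) (hg g0); lia.
Qed.

Lemma vge_weak n m f : vge n f -> m <= n -> vge m f.
Proof. by move=> hf mn f0; move: (hf f0); lia. Qed.

Lemma vge_val f : vge (val f) f.
Proof. by []. Qed.

Lemma val_add_dominant f g : f != 0 -> vge (val f + 1) g ->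
  f + g != 0 /\ val (f + g) = val f.
Proof.
move=> f0 hg; have s0 : f + g != 0.
  rewrite addr_eq0; apply: contraTneq f0 => Ef.
  move: hg; rewrite Ef /vge valN.
  by case: eqP => [->|_ /(_ isT)]; rewrite ?oppr0 ?eqxx //; lia.
split=> //.
have h1 : vge (val f) (f + g).
  by apply: vgeD; [apply: vge_val | apply: (vge_weak hg); lia].
have {}h1 := h1 s0.
have [//|h2] : val (f + g) = val f \/ val f + 1 <= val (f + g) by lia.
have : vge (val f + 1) (f + g - g) by apply: vgeB => // _.
by rewrite addrK /vge => /(_ f0); lia.
Qed.

Lemma vge_fder f : vge (val f + kap) (fder f).
Proof.
have [->|f0] := eqVneq f 0; first by rewrite /vge fder0 eqxx.
have [p [q [p0 q0 ->]]] := frac_nz f0.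
rewrite fder_div // val_div //.
have io_ge r : r != 0 -> vge (w r) (io r) by move=> r0 _; rewrite val_io.
have der_ge r : vge (w r + kap) (io r^`()).
  by rewrite /vge io_eq0 => r0; rewrite val_io // (place_deriv wP).
have -> : w p - w q + kap = (w p + w q + kap) + - (2 * w q) by lia.
apply: vge_mul; last first.
  by move=> _; rewrite valV ?expf_neq0 ?io_eq0 // valX ?io_eq0 // val_io.
have -> : w p + w q + kap = w p + kap + w q by lia.
apply: vgeB; first by apply: vge_mul; [apply: der_ge | apply: io_ge].
apply: (@vge_weak (w p + (w q + kap))); last by lia.
by apply: vge_mul; [apply: io_ge | apply: der_ge].
Qed.

Lemma vgeV n f : val f <= - n -> vge n f^-1.
Proof. by rewrite /vge invr_eq0 => h f0; rewrite valV //; lia. Qed.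

(* For f = (1 + eps)^2 / (4 eps) this is the square of eps' / eps; it is 0 at the
   junk points f = 0 and f = 1. *)
Definition tderiv f : K := fder f ^+ 2 / (f * (f - 1)).

Lemma vge_tderiv_gen z f : f != 0 -> f != 1 -> vge z (fder f) ->
  vge (2 * z - val f - val (f - 1)) (tderiv f).
Proof.
move=> f0 f1 hz; rewrite -subr_eq0 in f1.
have -> : 2 * z - val f - val (f - 1) = z + z + (- val f - val (f - 1)) by lia.
apply: vge_mul; first by apply: vge_mul.
by apply: vgeV; rewrite valM //; lia.
Qed.

Lemma vge_fder_sub1 f : vge (val (f - 1) + kap) (fder f).
Proof. by have := @vge_fder (f - 1); rewrite fderB fder1 subr0. Qed.

(** As f and f - 1 have the same derivative, it is estimated through the one of larger order, which
    offsets the denominator. *)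
Lemma vge_tderiv f : vge (2 * kap) (tderiv f).
Proof.
have [->|f0] := eqVneq f 0; first by rewrite /vge /tderiv mul0r invr0 mulr0 eqxx.
have [->|f1] := eqVneq f 1; first by rewrite /vge /tderiv subrr mulr0 invr0 mulr0 eqxx.
have [le_v|le_v] : val f <= val (f - 1) \/ val (f - 1) <= val f by lia.
- by apply: (vge_weak (vge_tderiv_gen f0 f1 (@vge_fder_sub1 f))); lia.
- by apply: (vge_weak (vge_tderiv_gen f0 f1 (@vge_fder f))); lia.
Qed.

Lemma placeX p k : p != 0 -> w (p ^+ k) = k%:Z * w p.
Proof. by move=> p0; rewrite -!val_io ?expf_neq0 // rmorphXn valX ?io_eq0. Qed.

Lemma placeN p : w (- p) = w p.
Proof.
have [->|p0] := eqVneq p 0; first by rewrite oppr0.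
by rewrite -!val_io ?oppr_eq0 // rmorphN valN.
Qed.

Lemma vge_nat i : vge 0 i%:R.
Proof.
elim: i => [|i IH]; first by rewrite /vge eqxx.
by rewrite mulrS; apply: vgeD => // _; rewrite val1.
Qed.

(** With A = al' / al and W = om' / om, the logarithmic derivative of al om^2 is A + 2 W. The terms
    are grouped so that each has a factor, W or 1 - om^2, that vanishes to high order where om is
    close to -1. *)
Lemma tderiv_sub al om : al != 0 -> om != 0 -> al != 1 -> al * om ^+ 2 != 1 ->
  tderiv (al * om ^+ 2) - tderiv al =
  (al * om ^+ 2) * (al * om ^+ 2 - 1)^-1
    * (4%:R * (fder om / om * (fder al / al + fder om / om)))
  + (fder al / al * (fder al / al)) * (al * (1 - om ^+ 2))
    * ((al * om ^+ 2 - 1)^-1 * (al - 1)^-1).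
Proof.
move=> al0 om0 al1 nu1.
have E : fder (al * om ^+ 2) =
    fder al * om ^+ 2 + al * (fder om * om + om * fder om).
  by rewrite fderM expr2 fderM.
rewrite -subr_eq0 in nu1; rewrite -subr_eq0 in al1.
by rewrite /tderiv E; field; rewrite nu1 al1 al0.
Qed.

(** Since om is -1 to order m, it is a unit, and al om^2 - 1 has the order B of al - 1 because al (1
    - om^2) has order at least k + m > B. The three bounds on n come from the terms in W A, W^2 and
    A^2 (1 - om^2) of [tderiv_sub], where A = al' / al and W = om' / om. *)
Lemma vge_tderiv_sub n z al om (k := val al) (B := val (al - 1))
    (m := val (1 + om)) :
  kap = -1 -> al != 0 -> om != 0 -> al != 1 -> al * om ^+ 2 != 1 ->
  1 + om != 0 -> vge z (fder al) -> 0 < m -> B < k + m ->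
  n <= m - 1 - B + z -> n <= k - B + 2 * (m - 1) -> n <= 2 * z - k + m - 2 * B ->
  vge n (tderiv (al * om ^+ 2) - tderiv al).
Proof.
move=> kapE al0 om0 al1 nu1 om1 hz m0 lt_B n1 n2 n3; rewrite tderiv_sub //.
rewrite -subr_eq0 in al1; rewrite -subr_eq0 in nu1.
have v_om : val om = 0.
  have N1 : (-1 : K) != 0 by rewrite oppr_eq0 oner_eq0.
  have om1_gt0 : vge (val (-1) + 1) (1 + om).
    by rewrite valN val1 => _; rewrite -/m; lia.
  by have [_] := val_add_dominant N1 om1_gt0; rewrite addKr valN val1.
have om2 : vge m (1 - om ^+ 2).
  have -> : 1 - om ^+ 2 = (1 + om) * (1 - om) by ring.
  rewrite -[m]addr0; apply: vge_mul => //; apply: vgeB => _; rewrite ?val1 //.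
  by rewrite v_om.
have al_om2 : vge (k + m) (al * (1 - om ^+ 2)) by apply: vge_mul.
have v_nu1 : val (al * om ^+ 2 - 1) = B.
  have -> : al * om ^+ 2 - 1 = al - 1 + - (al * (1 - om ^+ 2)) by ring.
  apply: (proj2 (val_add_dominant al1 _)); apply: vgeN.
  by apply: (vge_weak al_om2); rewrite -/B; lia.
have d_om : vge (m - 1) (fder om).
  have := @vge_fder (1 + om); rewrite fderD fder1 add0r => h.
  by apply: (vge_weak h); rewrite -/m; lia.
have d_al : vge (z - k) (fder al / al).
  by apply: vge_mul => //; apply: vgeV; rewrite -/k; lia.
have ld_om : vge (m - 1) (fder om / om).
  by rewrite -[m - 1]addr0; apply: vge_mul => //; apply: vgeV; rewrite v_om.
have v_nu : vge k (al * om ^+ 2).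
  by rewrite -[k]addr0; apply: vge_mul => // _; rewrite valX // v_om mulr0.
have i_nu : vge (- B) (al * om ^+ 2 - 1)^-1 by apply: vgeV; rewrite v_nu1; lia.
have i_al : vge (- B) (al - 1)^-1 by apply: vgeV; rewrite -/B; lia.
apply: vgeD.
- have h1 : vge (n - (k - B + (m - 1))) (fder al / al + fder om / om).
    by apply: vgeD; [apply: (vge_weak d_al) | apply: (vge_weak ld_om)]; lia.
  have h := vge_mul (vge_mul v_nu i_nu) (vge_mul (@vge_nat 4) (vge_mul ld_om h1)).
  by apply: (vge_weak h); lia.
- have h := vge_mul (vge_mul (vge_mul d_al d_al) al_om2) (vge_mul i_nu i_al).
  by apply: (vge_weak h); lia.
Qed.

End Valuation.

(** * Finite places and the place at infinity *)

Definition ord_at (r : F) p : int := (mup r p)%:Z.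
Definition ord_inf p : int := - (size p).-1%:Z.

Lemma place_at r : place (ord_at r) (-1).
Proof.
split=> [p q p0 q0|n p q p0 q0 s0|p p'0]; rewrite /ord_at.
- by rewrite mupM.
- case: n => [n|n]; last by lia.
  rewrite !lez_nat !mup_geq //; exact: dvdp_add.
have p0 : p != 0 by apply: contraNneq p'0 => ->; rewrite deriv0.
suff : ((mup r p).-1 <= mup r p^`())%N by lia.
rewrite mup_geq //.
have : ('X - r%:P) ^+ mup r p %| p by rewrite -mup_geq.
case: (mup r p) => [|m] /=; first by rewrite expr0 !dvd1p.
case/dvdpP=> u ->; rewrite derivM deriv_exp derivXsubC mul1r.
rewrite dvdp_add ?dvdp_mull // ?exprS ?dvdp_mull //.
by rewrite -mulr_natr dvdp_mulr.
Qed.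

Lemma place_inf : place ord_inf 1.
Proof.
split=> [p q p0 q0|n p q p0 q0 s0|p p'0]; rewrite /ord_inf.
- have sp : (0 < size p)%N by rewrite size_poly_gt0.
  have sq : (0 < size q)%N by rewrite size_poly_gt0.
  rewrite size_mul //; case: (size p) sp => // m _; case: (size q) sq => // k _.
  by rewrite addnS addSn /= PoszD opprD.
- move: (size_poly_gt0 p) (size_poly_gt0 q) (size_poly_gt0 (p + q)).
  by rewrite p0 q0 s0; have := size_polyD p q; lia.
have p0 : p != 0 by apply: contraNneq p'0 => ->; rewrite deriv0.
by have := lt_size_deriv p0; have := size_poly_gt0 p^`(); rewrite p'0; lia.
Qed.

Lemma ord_at_root r p : p != 0 -> root p r = (0 < ord_at r p).
Proof. by move=> p0; rewrite root_factor_theorem XsubC_dvd. Qed.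

Lemma coprimep_ord_at r p q : p != 0 -> q != 0 -> coprimep p q ->
  0 < ord_at r p -> ord_at r q = 0.
Proof.
move=> p0 q0 cpq; rewrite -ord_at_root // => rp.
have : ~~ root q r.
  by rewrite rootE (coprimep_root cpq).
by rewrite ord_at_root // /ord_at; case: (mup r q).
Qed.

(** In lowest terms the denominator does not vanish at r, so the loss of 1 in [vge_fder] is
    avoided. *)
Lemma vge_fder_at r f : vge (ord_at r) 0 f -> vge (ord_at r) 0 (fder f).
Proof.
have [->|f0] := eqVneq f 0.
  by rewrite /vge fder0 eqxx.
move=> /(_ f0); have [p [q [q0 cpq Ef]]] := frac_coprime f.
have p0 : p != 0 by apply: contraNneq f0 => P0; rewrite Ef P0 rmorph0 mul0r.
have wP := place_at r.
rewrite Ef (val_div wP) // fder_div // => h.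
have ord_ge0 u : 0 <= ord_at r u by [].
have q_unit : ord_at r q = 0.
  have [hp|hp] : 0 < ord_at r p \/ ord_at r p <= 0 by lia.
    exact: coprimep_ord_at hp.
  by move: (ord_ge0 q); lia.
have io_ge u : vge (ord_at r) 0 (io u).
  by rewrite /vge io_eq0 => u0; rewrite (val_io wP).
rewrite -[0]addr0; apply: (vge_mul wP); last first.
  by apply: (vgeV wP); rewrite (valX wP) ?io_eq0 // (val_io wP) // q_unit.
by apply: (vgeB wP); rewrite -[0]addr0; apply: (vge_mul wP).
Qed.

(** At most one of the orders e1 of f and e2 of f - 1 is positive, and f' has order at least max(0,
    e1 - 1, e2 - 1). Twice this minus e1 + e2 is at least -1, and is negative only if e1 or e2 is
    1. *)
Lemma vge_tderiv_at r f : 0 <= val (ord_at r) f ->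
  vge (ord_at r) (-1) (tderiv f)
  /\ (val (ord_at r) f <> 1 -> val (ord_at r) (f - 1) <> 1 ->
      vge (ord_at r) 0 (tderiv f)).
Proof.
have wP := place_at r; set w := ord_at r => f_ge0.
have [->|f0] := eqVneq f 0.
  by rewrite /vge /tderiv mul0r invr0 mulr0 eqxx.
have [->|f1] := eqVneq f 1.
  by rewrite /vge /tderiv subrr mulr0 invr0 mulr0 eqxx.
have h0 := vge_tderiv_gen wP f0 f1 (vge_fder_at (fun _ => f_ge0)).
have h1 := vge_tderiv_gen wP f0 f1 (vge_fder wP (f := f)).
have h2 := vge_tderiv_gen wP f0 f1 (vge_fder_sub1 wP (f := f)).
have N1 : (-1 : K) != 0 by rewrite oppr_eq0 oner_neq0.
have valN1 : val w (-1) = 0 by rewrite (valN wP) (val1 wP).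
have e12 : 0 < val w f -> val w (f - 1) = 0.
  move=> f_gt0; rewrite addrC.
  suff [_ ->] : -1 + f != 0 /\ val w (-1 + f) = val w (-1) by [].
  by apply: (val_add_dominant wP) => // _; rewrite valN1 add0r -gtz0_ge1.
have f1_ge0 : 0 <= val w (f - 1).
  have : vge w 0 (f - 1) by apply: (vgeB wP) => // _; rewrite (val1 wP).
  by apply; rewrite subr_eq0.
rewrite -/w in h0 h1 h2 f_ge0.
move: (val w f) (val w (f - 1)) h0 h1 h2 e12 f_ge0 f1_ge0 => e1 e2.
rewrite /vge => h0 h1 h2 e12 e1_ge0 e2_ge0.
split=> [T0|e1_1 e2_1 T0]; move: (h0 T0) (h1 T0) (h2 T0) e12.
  by move: (val w _) => t; clear -e1_ge0 e2_ge0; lia.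
by move: (val w _) => t; clear -e1_ge0 e2_ge0 e1_1 e2_1; lia.
Qed.

(** A function without finite poles is a polynomial. This turns the local estimates into height
    bounds. *)
Lemma val_inf_le0 f : f != 0 -> (forall r, 0 <= val (ord_at r) f) ->
  val ord_inf f <= 0.
Proof.
move=> f0; have [p [q [q0 cpq Ef]]] := frac_coprime f.
have p0 : p != 0 by apply: contraNneq f0 => P0; rewrite Ef P0 rmorph0 mul0r.
rewrite Ef (val_div place_inf) // => h.
have [/eqP sq|sq] := boolP (size q == 1%N); first by rewrite /ord_inf sq; lia.
have [r rq] := closed_rootP q sq.
move: (h r); rewrite (val_div (place_at r)) //.
move: rq; rewrite ord_at_root // => rq.
have := @coprimep_ord_at r q p q0 p0; rewrite coprimep_sym => /(_ cpq rq); lia.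
Qed.

(** * Frobenius powers in characteristic l *)

Variables (l : nat).
Hypothesis charF : l \in [pchar F].

Lemma pth_root_exists (a : F) : exists b, b ^+ l == a.
Proof.
have l0 : (0 < l)%N by rewrite prime_gt0 // (pcharf_prime charF).
have s : size ('X^l - a%:P) != 1%N.
  by rewrite size_XnsubC //; case: (l) l0.
have [b] := closed_rootP _ s; rewrite rootE !hornerE subr_eq0 => Eb.
by exists b.
Qed.

(** Only exponents divisible by l survive, and the coefficients have l-th roots in F. *)
Lemma deriv0_pth_power p : p^`() = 0 -> exists q, p = q ^+ l.
Proof.
move=> p'0; have l_pr := pcharf_prime charF.
have l0 := prime_gt0 l_pr.
pose b i := xchoose (pth_root_exists p`_(i * l)).
have bE i : b i ^+ l = p`_(i * l) by apply/eqP/(xchooseP (pth_root_exists _)).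
have charP : l \in [pchar {poly F}] by rewrite (rmorph_pchar polyC).
exists (\sum_(i < size p) b i *: 'X^i).
rewrite -(pFrobenius_autE charP) rmorph_sum /=; apply/polyP=> j.
rewrite coef_sum.
under eq_bigr => i _ do rewrite pFrobenius_autE exprZn bE -exprM coefZ coefXn.
have [/dvdnP[k Ej]|nj] := boolP (l %| j)%N; last first.
  rewrite big1 => [|i _]; last first.
    by case: eqP => [Ej|]; [rewrite Ej dvdn_mull in nj | rewrite mulr0].
  have := congr1 (fun u : {poly F} => u`_j.-1) p'0; rewrite coef_deriv coef0.
  have j0 : (0 < j)%N by case: (j) nj; rewrite ?dvdn0.
  rewrite prednK // -mulr_natr => /eqP; rewrite mulf_eq0.
  by rewrite -(dvdn_pcharf charF) (negPf nj) orbF => /eqP.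
have [lt_k|le_k] := ltnP k (size p); last first.
  rewrite nth_default ?Ej; last by rewrite (leq_trans le_k) // leq_pmulr.
  rewrite big1 // => i _; rewrite eqn_pmul2r // gtn_eqF ?mulr0 //.
  exact: leq_trans (ltn_ord i) le_k.
rewrite (bigD1 (Ordinal lt_k)) //= Ej eqxx mulr1 big1 ?addr0 // => i ne.
rewrite eqn_pmul2r // eq_sym; case: eqP => [E|]; rewrite ?mulr0 //.
by case/eqP: ne; apply: val_inj.
Qed.

(** In lowest terms p' q = p q' forces p to divide p' and q to divide q', so both derivatives vanish
    by degree. *)
Lemma fder0_pth_power f : fder f = 0 -> exists g, f = g ^+ l.
Proof.
have l0 := prime_gt0 (pcharf_prime charF).
have [->|f0] := eqVneq f 0; first by exists 0; rewrite expr0n gtn_eqF.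
have [p [q [q0 cpq Ef]]] := frac_coprime f.
have p0 : p != 0 by apply: contraNneq f0 => P0; rewrite Ef P0 rmorph0 mul0r.
rewrite Ef fder_div // => /eqP.
rewrite mulf_eq0 invr_eq0 expf_eq0 /= io_eq0 (negPf q0) orbF.
rewrite -!rmorphM subr_eq0 (inj_eq io_inj) => /eqP E.
have der0 (u : {poly F}) : u != 0 -> u %| u^`() -> u^`() = 0.
  move=> u0 du; apply/eqP; apply: contraLR (lt_size_deriv u0) => u'0.
  by rewrite -leqNgt dvdp_leq.
have p'0 : p^`() = 0.
  by apply: der0; rewrite // -(Gauss_dvdpl _ cpq) E dvdp_mulr.
have q'0 : q^`() = 0.
  rewrite coprimep_sym in cpq.
  by apply: der0; rewrite // -(Gauss_dvdpr _ cpq) -E dvdp_mull.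
have [P ->] := deriv0_pth_power p'0; have [Q ->] := deriv0_pth_power q'0.
by exists (io P / io Q); rewrite expr_div_n -!rmorphXn.
Qed.

Lemma charK : l \in [pchar K].
Proof. by rewrite (rmorph_pchar (io \o polyC)). Qed.

Lemma pchar_pow i : [pchar K].-nat (l ^ i)%N.
Proof.
by rewrite pnatX pnatE ?charK // (pcharf_prime charF).
Qed.

Lemma pow_frobB i f g : (f - g) ^+ (l ^ i) = f ^+ (l ^ i) - g ^+ (l ^ i).
Proof. by rewrite exprDn_pchar ?exprNn_pchar ?pchar_pow. Qed.

Lemma pow_frob_inj i f g : f ^+ (l ^ i) = g ^+ (l ^ i) -> f = g.
Proof.
move/eqP; rewrite -subr_eq0 -pow_frobB expf_eq0 => /andP[_].
by rewrite subr_eq0 => /eqP.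
Qed.

Definition ppower i f := exists g, f = g ^+ (l ^ i).

Lemma ppower0 f : ppower 0 f.
Proof. by exists f; rewrite expr1. Qed.

Lemma ppower1 i : ppower i 1.
Proof. by exists 1; rewrite expr1n. Qed.

Lemma ppowerM i f g : ppower i f -> ppower i g -> ppower i (f * g).
Proof. by move=> [u ->] [v ->]; exists (u * v); rewrite exprMn. Qed.

Lemma ppowerV i f : ppower i f -> ppower i f^-1.
Proof. by move=> [u ->]; exists u^-1; rewrite exprVn. Qed.

Lemma ppowerB i f g : ppower i f -> ppower i g -> ppower i (f - g).
Proof. by move=> [u ->] [v ->]; exists (u - v); rewrite pow_frobB. Qed.

Lemma ppowerN i f : ppower i f -> ppower i (- f).
Proof. by move=> [u ->]; exists (- u); rewrite exprNn_pchar ?pchar_pow. Qed.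

Lemma ppowerD i f g : ppower i f -> ppower i g -> ppower i (f + g).
Proof.
by move=> hf hg; rewrite -[g]opprK; apply: ppowerB => //; apply: ppowerN.
Qed.

Lemma ppowerX i f k : ppower i f -> ppower i (f ^+ k).
Proof. by move=> [u ->]; exists (u ^+ k); rewrite -!exprM mulnC. Qed.

Lemma ppower_const i (a : F) : ppower i (io a%:P).
Proof.
elim: i a => [|i IH] a; first exact: ppower0.
have [b /eqP Eb] := pth_root_exists a.
have [u Eu] := IH b; exists u.
by rewrite expnSr exprM -Eu -rmorphXn -rmorphXn Eb.
Qed.

Lemma ppower_step i f : fder f = 0 ->
  ppower i.+1 (f ^+ (l ^ i)).
Proof.
move=> /fder0_pth_power[g ->]; exists g.
by rewrite -exprM expnS.
Qed.

Hypothesis l_odd : odd l.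

Lemma two_neq0 : (2%:R : K) != 0.
Proof.
rewrite -(dvdn_pcharf charK); apply/negP=> /dvdn_leq => /(_ isT).
by move: l_odd (prime_gt1 (pcharf_prime charF)); case: (l) => [|[|[|]]].
Qed.

Lemma four_neq0 : (4%:R : K) != 0.
Proof. by rewrite (natrM K 2 2) mulf_neq0 ?two_neq0. Qed.

(** Write l^i = 2 r + 1. If f^2 = g^(l^i), then f^(l^i) = f (g^r)^(l^i), so f is the l^i-th power of
    f / g^r. *)
Lemma ppower_sqrt i f : ppower i (f ^+ 2) -> ppower i f.
Proof.
have [->|f0] := eqVneq f 0; first by rewrite expr0n.
move=> [g Eg]; have := odd_double_half (l ^ i); rewrite oddX l_odd orbT.
set r := _./2; rewrite add1n => /esym Er.
have E : f ^+ (l ^ i) = f * (g ^+ r) ^+ (l ^ i).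
  by rewrite {1}Er exprS -mul2n exprM Eg -!exprM mulnC.
have g0 : g != 0.
  apply: contraNneq (expf_neq0 2 f0); rewrite Eg => ->.
  by rewrite expr0n Er.
by exists (f / g ^+ r); rewrite expr_div_n E mulfK // !expf_neq0.
Qed.

Lemma ord_at_const r (u : F) : u != 0 -> ord_at r u%:P = 0.
Proof. by move=> u0; rewrite /ord_at mupNroot ?rootC. Qed.

Lemma ord_inf_const (u : F) : ord_inf u%:P = 0.
Proof. by rewrite /ord_inf size_polyC; case: eqP. Qed.

Lemma two_poly : (2%:R : {poly F}) = (2%:R)%:P.
Proof. by rewrite polyC_natr. Qed.

Lemma two_neq0F : (2%:R : F) != 0.
Proof. by rewrite -(dvdn_pcharf charF) (dvdn_pcharf charK) two_neq0. Qed.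

(** * Height bounds from logarithmic derivatives *)

(* Local numerology at a root r of rho = r1 r2 or away from it: e1, e2, t are the
   orders of s0, 1 - s0 and of f'^2 / (f (f - 1)) at f = s0; away from rho, e2 is a
   multiple of 4 and e1 + e2 is even unless d vanishes. *)
Lemma split_arith (k q e1 e2 t rh dl : int) : q = 2 * k + 1 -> 0 <= k ->
  2 * -1 <= t -> 2 * (e1 - 1) - e1 - e2 <= t -> 2 * (e2 - 1) - e1 - e2 <= t ->
  (0 <= e1 -> 2 * 0 - e1 - e2 <= t) ->
  (0 < e1 -> e2 = 0) -> (0 < e2 -> e1 = 0) -> 0 <= rh -> 0 <= dl ->
  (rh = 0 -> [/\ 0 <= q * e1, 0 <= q * e2,
     dl = 0 -> exists u, q * e1 + q * e2 = u + u
     & 0 < e2 -> exists u, q * e2 = 4 * u]) ->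
  0 <= 2 * t + 4 * rh + 2 * dl - e2.
Proof.
move=> qE k0 t1 t2 t3 t4 e12 e21 rh0 dl0 good.
have [rhE|rh1] : rh = 0 \/ 0 < rh by lia.
  have [e1_ge0 e2_ge0 h1 h2] := good rhE.
  have q0 : 0 < q by lia.
  rewrite !pmulr_rge0 // in e1_ge0 e2_ge0.
  have [e2_0|e2_gt0] : e2 = 0 \/ 0 < e2 by lia.
    have [dlE|dl1] : dl = 0 \/ 0 < dl by lia.
      have e1_odd : e1 <> 1.
        by move=> E; have [u] := h1 dlE; rewrite E e2_0; lia.
      by lia.
    by lia.
  have [u Eu] := h2 e2_gt0.
  (* For e2 >= 4, t >= e2 - 2 gives 2 t >= e2; the values 1, 2, 3 are excluded as q is odd and 4
     divides q e2. *)
  have [e2_ge4|[E|[E|E]]] : 4 <= e2 \/ e2 = 1 \/ e2 = 2 \/ e2 = 3 by lia.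
  - by have := e21 e2_gt0; lia.
  - by move: Eu; rewrite E; lia.
  - by move: Eu; rewrite E; lia.
  - by move: Eu; rewrite E; lia.
have [e2_gt0|e2_le0] : 0 < e2 \/ e2 <= 0 by lia.
  by have := e21 e2_gt0; lia.
by lia.
Qed.

(* Same for the difference at f = al om^2 and f = al: k, B, m, t are the orders of al,
   al - 1, 1 + om and of this difference; bd z means that al' has order >= z. If
   B >= k + m, then k = 0 and q m <= q B <= wb, so the loss is absorbed by b. *)
Lemma nonsplit_arith (j q k B m t rh dl wa wb wc wx : int) (bd : int -> Prop) :
  q = 2 * j + 1 -> 0 <= j -> q * k = 2 * wa - wc -> q * B = wb - wc ->
  q * m = 2 * wx - wa -> 2 * -1 <= t ->
  (forall z n, bd z -> 0 < m -> B < k + m -> n <= m - 1 - B + z ->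
     n <= k - B + 2 * (m - 1) -> n <= 2 * z - k + m - 2 * B -> n <= t) ->
  bd (k - 1) -> bd (B - 1) -> (0 <= k -> bd 0) ->
  (0 < k -> B = 0) -> (k < 0 -> B = k) -> (0 < B -> k = 0) ->
  0 <= rh -> 0 <= dl -> 0 <= wa -> 0 <= wb -> 0 <= wc ->
  (rh = 0 -> [/\ wb = 0, wc = 0 & 0 <= t + dl]) ->
  0 <= q * (2 * t + 4 * rh + 2 * dl) + (wb + wa) - 2 * wx.
Proof.
move=> qE j0 qk qB qm t2 tz bdk bdB bd0 kB kB' Bk rh0 dl0 wa0 wb0 wc0 good.
have q0 : 0 < q by lia.
have -> : q * (2 * t + 4 * rh + 2 * dl) + (wb + wa) - 2 * wx =
    q * (2 * t + 4 * rh + 2 * dl - m) + wb by lia.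
have enough : 0 <= 2 * t + 4 * rh + 2 * dl - m ->
    0 <= q * (2 * t + 4 * rh + 2 * dl - m) + wb.
  by move=> h; rewrite addr_ge0 // mulr_ge0 // ltW.
have [rhE|rh1] : rh = 0 \/ 0 < rh by lia.
  have [wbE wcE td] := good rhE; apply: enough.
  have BE : B = 0.
    have /eqP : q * B = 0 by lia.
    by rewrite mulf_eq0 gt_eqF //= => /eqP.
  have k_ge0 : 0 <= k by rewrite -(pmulr_rge0 _ q0); lia.
  have [m_le0|m_gt0] : m <= 0 \/ 0 < m by lia.
    by lia.
  have [kE|k_gt0] : k = 0 \/ 0 < k by lia.
    have : m - 1 <= t by apply: (tz 0) => //; [exact: bd0 | lia ..].
    (* Here wa = 0, so m = 1 would make the odd q equal to 2 wx. *)
    have : m <> 1 by move=> mE; move: qm qk; rewrite mE kE; lia.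
    by lia.
  have k_neq1 : k <> 1 by move=> kE; move: qk; rewrite kE; lia.
  have : m <= t by apply: (tz (k - 1)) => //; lia.
  by lia.
have [m_le0|m_gt0] : m <= 0 \/ 0 < m by lia.
  by apply: enough; lia.
have [lt_B|ge_B] : B < k + m \/ k + m <= B by lia.
  apply: enough; have : m - 2 <= t; last by lia.
  have [le_kB|lt_kB] : B <= k \/ k < B by lia.
    by apply: (tz (k - 1)) => //; lia.
  by apply: (tz (B - 1)) => //; lia.
have : 0 <= q * (2 * t + 4 * rh + 2 * dl) by rewrite mulr_ge0 ?(ltW q0) //; lia.
have : q * m <= q * B by rewrite ler_pM2l //; lia.
by lia.
Qed.

Section Orbit.

Variables (a c d x y rho : {poly F}).
Local Notation v := (x ^+ 2 - a).
Local Notation b := (a ^+ 2 - c).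
Hypotheses (c0 : c != 0) (b0 : b != 0) (d0 : d != 0) (x0 : x != 0).
Hypothesis yE : d * y ^+ 2 = v ^+ 2 - c.
Hypotheses (rho0 : rho != 0)
  (rho_root : forall r, root (b * c) r -> root rho r).

Lemma bad_point r : ord_at r rho = 0 -> ord_at r b = 0 /\ ord_at r c = 0.
Proof.
move=> rho_r; have nr u : u != 0 -> u %| b * c -> ord_at r u = 0.
  move=> u0 /dvdpP[s Es]; have : ~~ (0 < ord_at r u); last by rewrite /ord_at; lia.
  rewrite -ord_at_root //; apply/negP=> ur.
  have : root rho r by apply: rho_root; rewrite Es rootM ur orbT.
  by rewrite ord_at_root // rho_r.
by split; apply: nr; rewrite ?dvdp_mulIl ?dvdp_mulIr.
Qed.

(* The case b d = h^2: then (c - a v - y h) / (2 c) is (1 + eps)^2 / (4 eps). *)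
Section SplitCase.

Variables (h : {poly F}) (k : nat) (s0 : K).
Hypothesis hE : h ^+ 2 = b * d.
Local Notation q := k.*2.+1.
Local Notation P := (c + a * v + y * h).
Local Notation P' := (c + a * v - y * h).
Local Notation Q := (c - a * v - y * h).
Hypotheses (s0E : s0 ^+ q = io Q / io (2%:R * c))
  (frobE : (1 - s0) ^+ q = 1 - s0 ^+ q) (ds0 : fder s0 != 0).

Let PP' : P * P' = c * x ^+ 4.
Proof. by rewrite (trace_conj_mul hE yE) subrK -exprM. Qed.

Let P0 : P != 0.
Proof.
apply/eqP=> E; have /eqP := PP'.
by rewrite E mul0r eq_sym mulf_eq0 expf_eq0 (negPf c0) (negPf x0).
Qed.

Let P'0 : P' != 0.
Proof.
apply/eqP=> E; have /eqP := PP'.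
by rewrite E mulr0 eq_sym mulf_eq0 expf_eq0 (negPf c0) (negPf x0).
Qed.

Let C0 : 2%:R * c != 0.
Proof. by rewrite mulf_neq0 // two_poly polyC_eq0 two_neq0F. Qed.

Let s00 : s0 != 0.
Proof. by apply: contraNneq ds0 => ->; rewrite fder0. Qed.

Let s01 : s0 != 1.
Proof. by apply: contraNneq ds0 => ->; rewrite fder1. Qed.

Let s01' : 1 - s0 != 0.
Proof. by rewrite subr_eq0 eq_sym. Qed.

Let Q0 : Q != 0.
Proof.
apply: contraNneq (expf_neq0 q s00) => E.
by rewrite s0E E rmorph0 mul0r.
Qed.

Let oneBs0E : (1 - s0) ^+ q = io P / io (2%:R * c).
Proof.
rewrite frobE s0E -[1](divff (_ : io (2%:R * c) != 0)) ?io_eq0 //.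
by rewrite -mulrBl -rmorphB; congr (io _ / _); ring.
Qed.

Let th0 : tderiv s0 != 0.
Proof.
rewrite /tderiv mulf_neq0 ?expf_neq0 // invr_neq0 // mulf_neq0 //.
by rewrite subr_eq0.
Qed.

(** At a common root, x and y h vanish, so v = - a there and (y h)^2 = b (v^2 - c) = b^2, which
    forces b to vanish. *)
Let both_traces_root r : ord_at r b = 0 -> ord_at r c = 0 ->
  root P r -> ~~ root P' r.
Proof.
move=> wb wc rP; apply/negP=> rP'.
have nb : ~~ root b r by rewrite ord_at_root // wb.
have nc : ~~ root c r by rewrite ord_at_root // wc.
have rx : root x r.
  have : root (c * x ^+ 4) r by rewrite -PP' rootM rP.
  by rewrite rootM (negPf nc) /= rootE horner_exp expf_eq0.
have ryh : root (y * h) r.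
  have : root (2%:R%:P * (y * h)) r.
    have -> : 2%:R%:P * (y * h) = P - P' by rewrite polyC_natr; ring.
    move: rP rP'; rewrite [root (P - P') r]rootE hornerD hornerN !rootE.
    by move=> /eqP -> /eqP ->; rewrite subrr.
  by rewrite rootM rootC (negPf two_neq0F).
case/negP: nb; have : root ((y * h) ^+ 2) r.
  by rewrite rootE horner_exp expf_eq0.
have -> : (y * h) ^+ 2 = b * (b + (x ^+ 3 - 2%:R * a * x) * x).
  by rewrite exprMn hE mulrCA -[y ^+ 2 * _]mulrC yE; ring.
rewrite rootM => /orP[//|]; rewrite !rootE hornerD hornerM.
by move: rx => /eqP ->; rewrite mulr0 addr0.
Qed.

Let split_local r :
  0 <= 2 * val (ord_at r) (tderiv s0) + 4 * ord_at r rho + 2 * ord_at r d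
       - val (ord_at r) (1 - s0).
Proof.
set w := ord_at r; have wP : place w (-1) := place_at r.
have w_ge0 u : 0 <= w u by [].
set t := val w (tderiv s0); set e2 := val w (1 - s0); set e1 := val w s0.
have wC : w (2%:R * c) = w c.
  rewrite (placeM wP) // ?two_poly ?polyC_eq0 ?two_neq0F //.
  by rewrite /w ord_at_const ?two_neq0F // add0r.
have q_e1 : q%:Z * e1 = w Q - w c.
  by rewrite -(valX wP) // s0E (val_div wP) // wC.
have q_e2 : q%:Z * e2 = w P - w c.
  by rewrite -(valX wP) // oneBs0E (val_div wP) // wC.
have e2' : val w (s0 - 1) = e2 by rewrite -opprB (valN wP).
have t_z z : vge w z (fder s0) -> 2 * z - e1 - e2 <= t.
  by move=> /(vge_tderiv_gen wP s00 s01) /(_ th0); rewrite e2'.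
have one_nz : (1 : K) != 0 := oner_neq0 K.
have ultra f : f != 0 -> 0 < val w f -> val w (1 - f) = 0.
  move=> f0 vf; have hf : vge w (val w 1 + 1) (- f).
    by apply: (vgeN wP) => _; rewrite (val1 wP) add0r -gtz0_ge1.
  by have [_ ->] := val_add_dominant wP one_nz hf; rewrite (val1 wP).
apply: (@split_arith k%:Z q%:Z e1) => //.
- by rewrite -muln2 -addn1 PoszD PoszM mulrC.
- exact: (vge_tderiv wP th0).
- exact: t_z (vge_fder wP (f := s0)).
- by apply: t_z; rewrite -e2'; exact: (vge_fder_sub1 wP (f := s0)).
- by move=> e1_ge0; apply: t_z; apply: vge_fder_at => _.
- exact: ultra.
- by move=> e2_gt0; rewrite /e1 -[s0](subKr 1) ultra.
move=> rho_r; have [wb wc] := bad_point rho_r; rewrite -/w in wb wc.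
rewrite q_e1 q_e2 wc !subr0; split=> //.
  (* Where d is a unit, [trace_disc] makes the order of Q P even. *)
  move=> d_r; have := trace_disc hE yE; set z := v * h + _ => Ez.
  have z0 : z != 0.
    apply: contraNneq (mulf_neq0 (mulf_neq0 Q0 P0) d0) => z0.
    by rewrite Ez z0 expr0n oppr0.
  exists (w z); have := congr1 w Ez.
  rewrite (placeN wP).
  by rewrite expr2 !(placeM wP) ?mulf_neq0 // d_r addr0.
(* P vanishes at r, so P' does not, and P P' = c x^4 gives P the order of x^4. *)
move=> e2_gt0; have wP' : w P' = 0.
  have rP : root P r.
    by rewrite ord_at_root // -/w -[w P]subr0 -[X in _ - X]wc -q_e2 pmulr_rgt0.
  have : ~~ root P' r by apply: both_traces_root.
  by rewrite ord_at_root // -/w -leNgt => wP'; apply/le_anti; rewrite wP' w_ge0.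
exists (w x); have := congr1 w PP'.
rewrite !(placeM wP) ?mulf_neq0 // wP' addr0 wc add0r => ->.
by move: (w x) => u; ring.
Qed.

(** By [split_local], G has no finite pole, so its order at infinity is at most 0. There [tderiv s0]
    has order at least 2, whence the summand -4, and q times the order of 1 - s0 is that of P /
    c. *)
Lemma split_height :
  - ord_inf P <= - ord_inf c
     + q%:Z * (4 * - ord_inf rho + 2 * - ord_inf d - 4).
Proof.
pose G := tderiv s0 ^+ 2 * io (rho ^+ 4 * d ^+ 2) / (1 - s0).
have R0 : rho ^+ 4 * d ^+ 2 != 0 by rewrite mulf_neq0 ?expf_neq0.
have ioR0 : io (rho ^+ 4 * d ^+ 2) != 0 by rewrite io_eq0.
have T0 : tderiv s0 ^+ 2 != 0 by rewrite expf_neq0.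
have valG w kap : place w kap -> val w G =
    2 * val w (tderiv s0) + (4 * w rho + 2 * w d) - val w (1 - s0).
  move=> wP; rewrite (valM wP (mulf_neq0 T0 ioR0) (invr_neq0 s01')).
  rewrite (valM wP T0 ioR0) (valV wP s01') (valX wP _ th0) (val_io wP R0).
  by rewrite (placeM wP) ?expf_neq0 // !(placeX wP).
have G0 : G != 0 := mulf_neq0 (mulf_neq0 T0 ioR0) (invr_neq0 s01').
have : val ord_inf G <= 0.
  apply: val_inf_le0 => // r; rewrite (valG _ _ (place_at r)) addrA.
  exact: split_local.
rewrite (valG _ _ place_inf) => G_le0.
have t2 := vge_tderiv place_inf (f := s0) th0.
have q_e2 : q%:Z * val ord_inf (1 - s0) = ord_inf P - ord_inf c.
  rewrite -(valX place_inf) // oneBs0E (val_div place_inf) //.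
  rewrite (placeM place_inf) // ?two_poly ?polyC_eq0 ?two_neq0F //.
  by rewrite ord_inf_const add0r.
rewrite -lerBlDl -opprD -q_e2 -mulrN ler_pM2l //.
move: t2 G_le0; clear; lia.
Qed.

End SplitCase.

(* Here al and om are q-th roots of a^2 / c and v / a. *)
Section NonsplitCase.

Variables (k : nat) (al om : K).
Local Notation q := k.*2.+1.
Local Notation nu := (al * om ^+ 2).
Local Notation th := (tderiv nu - tderiv al).
Hypotheses (a0 : a != 0) (v0 : v != 0) (y0 : y != 0).
Hypotheses (alE : al ^+ q = io (a ^+ 2) / io c) (omE : om ^+ q = io v / io a).
Hypotheses (al1E : (al - 1) ^+ q = al ^+ q - 1)
  (om1E : (1 + om) ^+ q = 1 + om ^+ q) (nu1E : (nu - 1) ^+ q = nu ^+ q - 1).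
Hypothesis th0 : th != 0.

Let neq0_of_pow f p1 p2 : f ^+ q = io p1 / io p2 -> p1 != 0 -> p2 != 0 ->
  f != 0.
Proof.
move=> E p10 p20; apply: contra_neq p10 => f0; apply/eqP.
rewrite -io_eq0; move/eqP: E; rewrite f0 expr0n eq_sym mulf_eq0 invr_eq0.
by rewrite !io_eq0 (negPf p20) orbF.
Qed.

Let al1E' : (al - 1) ^+ q = io b / io c.
Proof.
by rewrite al1E alE -[1](divff (_ : io c != 0)) ?io_eq0 // -mulrBl -rmorphB.
Qed.

Let om1E' : (1 + om) ^+ q = io (x ^+ 2) / io a.
Proof.
rewrite om1E omE -[1](divff (_ : io a != 0)) ?io_eq0 // -mulrDl -rmorphD.
by rewrite addrCA subrr addr0.
Qed.

Let nuE : nu ^+ q = io (v ^+ 2) / io c.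
Proof.
rewrite exprMn -exprM mulnC exprM alE omE !rmorphXn.
by field; rewrite !io_eq0 a0 c0.
Qed.

Let nu1E' : (nu - 1) ^+ q = io (d * y ^+ 2) / io c.
Proof.
rewrite nu1E nuE -[1](divff (_ : io c != 0)) ?io_eq0 //.
by rewrite -mulrBl -rmorphB yE.
Qed.

Let al0 : al != 0. Proof. by apply: neq0_of_pow alE _ _; rewrite ?expf_neq0. Qed.
Let om0 : om != 0. Proof. exact: neq0_of_pow omE _ _. Qed.
Let om10 : 1 + om != 0.
Proof. by apply: neq0_of_pow om1E' _ _; rewrite ?expf_neq0. Qed.
Let al10 : al - 1 != 0. Proof. exact: neq0_of_pow al1E' _ _. Qed.
Let nu0 : nu != 0. Proof. by rewrite mulf_neq0 ?expf_neq0. Qed.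
Let nu10 : nu - 1 != 0.
Proof. by apply: neq0_of_pow nu1E' _ _; rewrite ?mulf_neq0 ?expf_neq0. Qed.
Let al1 : al != 1. Proof. by rewrite -subr_eq0. Qed.
Let nu1 : nu != 1. Proof. by rewrite -subr_eq0. Qed.

Let val_root w kap f p1 p2 : place w kap ->
  f ^+ q = io p1 / io p2 -> f != 0 -> p1 != 0 -> p2 != 0 ->
  q%:Z * val w f = w p1 - w p2.
Proof. by move=> wP E f0 p10 p20; rewrite -(valX wP) // E (val_div wP). Qed.

Let nonsplit_local r :
  0 <= q%:Z * (2 * val (ord_at r) th + 4 * ord_at r rho + 2 * ord_at r d)
       + (ord_at r b + ord_at r a) - 2 * ord_at r x.
Proof.
set w := ord_at r; have wP : place w (-1) := place_at r.
have w_ge0 u : 0 <= w u by [].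
set t := val w th.
have qk : q%:Z * val w al = 2 * w a - w c.
  by rewrite (val_root wP alE) ?expf_neq0 // (placeX wP).
have qB : q%:Z * val w (al - 1) = w b - w c by rewrite (val_root wP al1E').
have qm : q%:Z * val w (1 + om) = 2 * w x - w a.
  by rewrite (val_root wP om1E') ?expf_neq0 // (placeX wP).
have qN : q%:Z * val w nu = 2 * w v - w c.
  by rewrite (val_root wP nuE) ?expf_neq0 // (placeX wP).
have qN1 : q%:Z * val w (nu - 1) = w d + 2 * w y - w c.
  rewrite (val_root wP nu1E') ?mulf_neq0 ?expf_neq0 //.
  by rewrite (placeM wP) ?expf_neq0 // (placeX wP).
have one_nz : (1 : K) != 0 := oner_neq0 K.
have N1 : (-1 : K) != 0 by rewrite oppr_eq0.
have valN1 : val w (-1) = 0 by rewrite (valN wP) (val1 wP).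
apply: (@nonsplit_arith k%:Z q%:Z (val w al) (val w (al - 1)) (val w (1 + om))
  t (w rho) (w d) (w a) (w b) (w c) (w x) (fun z => vge w z (fder al))) => //.
- by rewrite -muln2 -addn1 PoszD PoszM mulrC.
- exact: (vgeB wP (vge_tderiv wP (f := nu)) (vge_tderiv wP (f := al))).
- move=> z n hz m_gt0 lt_B h1 h2 h3.
  exact: (vge_tderiv_sub wP erefl al0 om0 al1 nu1 om10 hz m_gt0 lt_B h1 h2 h3).
- exact: (vge_fder wP (f := al)).
- exact: (vge_fder_sub1 wP (f := al)).
- by move=> k_ge0; apply: vge_fder_at => _.
- move=> k_gt0; rewrite addrC.
  suff [_ ->] : -1 + al != 0 /\ val w (-1 + al) = val w (-1) by [].
  by apply: (val_add_dominant wP) => // _; rewrite valN1 add0r -gtz0_ge1.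
- move=> k_lt0; suff [_ ->] : al - 1 != 0 /\ val w (al - 1) = val w al by [].
  apply: (val_add_dominant wP) => // _; rewrite valN1; move: k_lt0; clear; lia.
- move=> B_gt0; rewrite -[al](subrK 1) addrC -[RHS](val1 wP).
  suff [_ ->] : 1 + (al - 1) != 0 /\ val w (1 + (al - 1)) = val w 1 by [].
  by apply: (val_add_dominant wP) => // _; rewrite (val1 wP) add0r -gtz0_ge1.
move=> rho_r; have [wb wc] := bad_point rho_r; rewrite -/w in wb wc.
split=> //.
rewrite wc ?wb ?subr0 in qk qN qN1 qB.
have q0 : 0 < q%:Z by [].
have qE : q%:Z = 2 * k%:Z + 1 by rewrite -muln2 -addn1 PoszD PoszM mulrC.
have k_ge0 : 0 <= val w al.
  by rewrite -(pmulr_rge0 _ q0) qk mulr_ge0.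
have N_ge0 : 0 <= val w nu.
  by rewrite -(pmulr_rge0 _ q0) qN mulr_ge0.
have not1 (e u : int) : q%:Z * e = 2 * u -> e <> 1.
  by move=> + E; rewrite E qE; clear; lia.
have B0 : val w (al - 1) <> 1.
  by apply: (@not1 _ 0); rewrite qB mulr0.
(* As q is odd, q e = 2 u excludes e = 1. So the term at al is regular, and that at nu has at most a
   simple pole, only where d vanishes. *)
have [_ /(_ (not1 _ _ qk) B0) hal] := vge_tderiv_at k_ge0.
suff hnu : vge w (- w d) (tderiv nu).
  have hal' : vge w (- w d) (tderiv al) by apply: (vge_weak hal); rewrite oppr_le0.
  by have := vgeB wP hnu hal' th0; rewrite -/t -subr_ge0 opprK addrC.
have [d_r|d_r] := eqVneq (w d) 0.
  rewrite d_r oppr0; have [_] := vge_tderiv_at N_ge0; apply.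
    exact: not1 qN.
  by apply: (@not1 _ (w y)); rewrite qN1 d_r add0r.
apply: (vge_weak (proj1 (vge_tderiv_at N_ge0))).
rewrite lerN2 -gtz0_ge1 lt_neqAle eq_sym d_r; exact: w_ge0.
Qed.

(** Again G is regular at all finite points. Its factor a comes from the denominator of (1 + om)^q =
    x^2 / a, and b from the exceptional places in [nonsplit_arith]. *)
Lemma nonsplit_height :
  2 * - ord_inf x <= - ord_inf b - ord_inf a
     + q%:Z * (4 * - ord_inf rho + 2 * - ord_inf d - 4).
Proof.
pose G0 := th ^+ 2 * io (rho ^+ 4 * d ^+ 2).
pose G := G0 ^+ q * io (b * a) / io (x ^+ 2).
have R0 : rho ^+ 4 * d ^+ 2 != 0 by rewrite mulf_neq0 ?expf_neq0.
have ba0 : b * a != 0 by rewrite mulf_neq0.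
have x20 : x ^+ 2 != 0 by rewrite expf_neq0.
have ioR0 : io (rho ^+ 4 * d ^+ 2) != 0 by rewrite io_eq0.
have ioba0 : io (b * a) != 0 by rewrite io_eq0.
have iox0 : io (x ^+ 2) != 0 by rewrite io_eq0.
have T0 : th ^+ 2 != 0 by rewrite expf_neq0.
have G00 : G0 != 0 := mulf_neq0 T0 ioR0.
have Gq0 : G0 ^+ q != 0 by rewrite expf_neq0.
have valG w kap : place w kap -> val w G =
    q%:Z * (2 * val w th + 4 * w rho + 2 * w d) + (w b + w a) - 2 * w x.
  move=> wP; rewrite (valM wP (mulf_neq0 Gq0 ioba0) (invr_neq0 iox0)).
  rewrite (valM wP Gq0 ioba0) (valV wP iox0) !(val_io wP) // (valX wP _ G00).
  rewrite (valM wP T0 ioR0) (val_io wP R0) (valX wP _ th0).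
  rewrite (placeM wP) ?expf_neq0 // (placeM wP b0 a0) !(placeX wP) //.
  by ring.
have : val ord_inf G <= 0.
  apply: val_inf_le0 => [|r]; last by rewrite (valG _ _ (place_at r)) nonsplit_local.
  exact: mulf_neq0 (mulf_neq0 Gq0 ioba0) (invr_neq0 iox0).
rewrite (valG _ _ place_inf) => G_le0.
have t2 := vgeB place_inf (vge_tderiv place_inf (f := nu))
  (vge_tderiv place_inf (f := al)) th0.
have q0 : 0 <= q%:Z by [].
move: (q%:Z) q0 t2 G_le0 => Q Q0 t2 G_le0.
have := ler_wpM2l Q0 t2; move: G_le0; clear; lia.
Qed.

End NonsplitCase.

End Orbit.

(** * The height bound at the last separable level *)

(** In lowest terms the square of the denominator is prime to the numerator, so it divides 1. *)
Lemma io_square u f : io u = f ^+ 2 -> exists h, u = h ^+ 2.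
Proof.
have [p [q [q0 cpq ->]]] := frac_coprime f => /eqP.
rewrite expr_div_n -[io u]divr1 eqr_div ?oner_eq0 ?expf_neq0 ?io_eq0 //.
rewrite mulr1 -!rmorphXn -rmorphM (inj_eq io_inj) => /eqP E.
have q_unit : q ^+ 2 %| 1.
  have cop : coprimep (q ^+ 2) (p ^+ 2).
    by rewrite coprimep_expl // coprimep_expr // coprimep_sym.
  by rewrite -(Gauss_dvdpr _ cop) mulr1 -E dvdp_mull.
have : q %| 1 by apply: dvdp_trans q_unit; rewrite expr2 dvdp_mulr.
rewrite dvdp1 => /size_poly1P[r r0 Eq].
exists (r^-1 *: p); rewrite exprZn -E Eq -polyC_exp mulrC mul_polyC scalerA.
by rewrite -exprMn mulVf // expr1n scale1r.
Qed.

Lemma height_ord_inf (p : {poly F}) : (height p)%:Z = - ord_inf p.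
Proof. by rewrite /ord_inf opprK. Qed.

Lemma odd_double_succ (m : nat) : odd m -> exists k, m = k.*2.+1.
Proof. by move=> m_odd; exists m./2; rewrite -[LHS]odd_double_half m_odd. Qed.

Lemma last_level (P : nat -> Prop) n : P 0%N -> ~ P n.+1 ->
  exists i, [/\ (i <= n)%N, P i & ~ P i.+1].
Proof.
elim: n => [|n IH] P0 Pn; first by exists 0%N.
have [Pn'|nPn] := classic (P n.+1); first by exists n.+1.
by have [i [i_le Pi nPi]] := IH P0 nPn; exists i; split=> //; apply: leq_trans i_le _.
Qed.

Lemma odd_pow_l i : odd (l ^ i).
Proof. by rewrite oddX l_odd orbT. Qed.

Section OrbitHeight.

Variables (a c d x y rho : {poly F}) (e : nat).
Local Notation v := (x ^+ 2 - a).
Local Notation b := (a ^+ 2 - c).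
Hypotheses (a0 : a != 0) (c0 : c != 0) (b0 : b != 0) (d0 : d != 0)
  (x0 : x != 0) (y0 : y != 0) (v0 : v != 0).
Hypothesis yE : d * y ^+ 2 = v ^+ 2 - c.
Hypotheses (rho0 : rho != 0)
  (rho_root : forall r, root (b * c) r -> root rho r).
Hypothesis insep : forall i, ppower i (io (a ^+ 2) / io c) ->
  ppower i (io v / io a) -> (i <= e)%N.

Local Notation trace h := (io (c - a * v - y * h) / io (2%:R * c)).

Let io2c : io (2%:R * c) = 2%:R * io c.
Proof. by rewrite rmorphM rmorph_nat. Qed.

(** The sum and product of the traces are 1 - a v / c and (v - a)^2 / (4 c). So (v + a)^2 / (4 c) is
    an l^(e+1)-th power too, then (v - a) / (v + a) by [ppower_sqrt], and finally v / a and a^2 / c,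
    against [insep]. *)
Let traces_not_ppower h : h ^+ 2 = b * d ->
  ~ (ppower e.+1 (trace h) /\ ppower e.+1 (trace (- h))).
Proof.
move=> hE [t1 t2].
have C0 : io c != 0 by rewrite io_eq0.
have A0 : io a != 0 by rewrite io_eq0.
have V0 : io x ^+ 2 - io a != 0 by rewrite -rmorphXn -rmorphB io_eq0.
have X0 : io x ^+ 2 - io a + io a != 0 by rewrite subrK expf_neq0 ?io_eq0.
have av : ppower e.+1 (io a * io v / io c).
  have -> : io a * io v / io c = 1 - (trace h + trace (- h)).
    rewrite io2c !(rmorphB, rmorphM, rmorphN) /=.
    by field; rewrite two_neq0 C0.
  by apply: ppowerB; [exact: ppower1 | exact: ppowerD].
have vBa : ppower e.+1 ((io v - io a) ^+ 2 / (4%:R * io c)).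
  have E : (c - a * v - y * h) * (c - a * v - y * - h) = c * (v - a) ^+ 2.
    (* The norm identity is applied with - v in place of v. *)
    have yE' : d * y ^+ 2 = (- v) ^+ 2 - c by rewrite yE sqrrN.
    have -> : (v - a) ^+ 2 = (- v + a) ^+ 2 by ring.
    by rewrite -(trace_conj_mul hE yE'); ring.
  have -> : (io v - io a) ^+ 2 / (4%:R * io c) = trace h * trace (- h).
    rewrite mulf_div -rmorphM E io2c !(rmorphM, rmorphXn, rmorphB) /=.
    by field; rewrite C0 two_neq0 four_neq0.
  exact: ppowerM.
have vDa : ppower e.+1 ((io v + io a) ^+ 2 / (4%:R * io c)).
  have -> : (io v + io a) ^+ 2 / (4%:R * io c) =
      (io v - io a) ^+ 2 / (4%:R * io c) + io a * io v / io c.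
    by field; rewrite C0 four_neq0.
  exact: ppowerD.
set ze := (io v - io a) / (io v + io a).
have hze : ppower e.+1 ze.
  apply: ppower_sqrt.
  have -> : ze ^+ 2 = (io v - io a) ^+ 2 / (4%:R * io c)
      / ((io v + io a) ^+ 2 / (4%:R * io c)).
    by rewrite /ze; field; rewrite C0 four_neq0 X0.
  by apply: ppowerM => //; apply: ppowerV.
have om : ppower e.+1 (io v / io a).
  have -> : io v / io a = (1 + ze) / (1 - ze).
    rewrite /ze; field; rewrite X0 A0 andbT /=.
    by rewrite (_ : _ - _ = 2%:R * io a) ?mulf_neq0 ?two_neq0 //; ring.
  apply: ppowerM; first by apply: ppowerD => //; exact: ppower1.
  by apply: ppowerV; apply: ppowerB => //; exact: ppower1.
have al : ppower e.+1 (io (a ^+ 2) / io c).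
  have -> : io (a ^+ 2) / io c = io a * io v / io c / (io v / io a).
    by rewrite rmorphXn; field; rewrite V0 A0.
  by apply: ppowerM => //; apply: ppowerV.
by have := insep al om; rewrite ltnn.
Qed.

Let q_mono i (u : int) : (i <= e)%N -> 0 <= u ->
  (l ^ i)%:Z * (u - 4) <= (l ^ e)%:Z * u.
Proof.
move=> i_le u0; apply: (@le_trans _ _ ((l ^ i)%:Z * u)).
  by rewrite ler_wpM2l // gerBl.
by rewrite ler_wpM2r // lez_nat leq_exp2l // (prime_gt1 (pcharf_prime charF)).
Qed.

Let height_b : (height b <= 2 * height a + height c)%N.
Proof.
by apply: heightD_le; rewrite ?heightN ?heightX // ?leq_addr ?leq_addl.
Qed.

Hypotheses (a_lt_x : (height a < height x)%N) (c_lt_x : (height c < height x)%N).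

Let height_v : height v = (2 * height x)%N.
Proof.
rewrite heightD_dominant heightX // heightN.
by move: a_lt_x; clear; lia.
Qed.

(** An upper bound for one factor of P P' = c x^4 bounds the other from below. The height of y h
    comes from (y h)^2 = b (v^2 - c). *)
Let height_conj h : h ^+ 2 = b * d ->
  (height (c + a * v - y * h) <= 2 * height x + height a + height c)%N.
Proof.
move=> hE; apply: heightD_le; first apply: heightD_le.
- exact: leq_addl.
- apply: leq_trans (heightM_le _ _) _; rewrite height_v.
  by clear; lia.
have h0 : h != 0.
  have := mulf_neq0 b0 d0; rewrite -hE expf_eq0; by [].
have : height ((y * h) ^+ 2) = height (b * (d * y ^+ 2)).
  by congr height; rewrite exprMn hE; ring.
rewrite yE heightX ?mulf_neq0 // heightN => E.
have : (height (b * (v ^+ 2 - c)) <= height b + 4 * height x)%N.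
  apply: leq_trans (heightM_le _ _) _; rewrite leq_add2l.
  apply: heightD_le; rewrite ?heightN ?heightX // ?height_v.
    by clear; lia.
  by move: c_lt_x; clear; lia.
by rewrite -E; have := height_b; clear; lia.
Qed.

Lemma orbit_height :
  (2 * height x <= l ^ e * (4 * height rho + 2 * height d)
                   + 3 * height a + height c)%N.
Proof.
suff [i i_le] : exists2 i, (i <= e)%N &
    2 * (height x)%:Z <= 3 * (height a)%:Z + (height c)%:Z
      + (l ^ i)%:Z * (4 * (height rho)%:Z + 2 * (height d)%:Z - 4).
  have := @q_mono i (4 * (height rho)%:Z + 2 * (height d)%:Z) i_le.
  move=> /(_ isT); move: (l ^ i)%N (l ^ e)%N => qi qe; clear; lia.
have [[h hE]|nsq] := classic (exists h, h ^+ 2 = b * d).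
  (* One sign of h gives a trace that is no l^(e+1)-th power; at its last level i, the root has
     nonzero derivative. *)
  have [h' h'E nt] : exists2 h', h' ^+ 2 = b * d & ~ ppower e.+1 (trace h').
    have [t1|] := classic (ppower e.+1 (trace h)); last by exists h.
    exists (- h); first by rewrite sqrrN.
    by move=> t2; apply: (traces_not_ppower hE).
  have [i [i_le [s0 s0E] ns]] := last_level (P := ppower^~ (trace h')) (ppower0 _) nt.
  exists i => //.
  have ds0 : fder s0 != 0.
    by apply/eqP=> ds0; apply: ns; rewrite s0E; apply: ppower_step.
  have fE : (1 - s0) ^+ (l ^ i) = 1 - s0 ^+ (l ^ i) by rewrite pow_frobB expr1n.
  have [k kE] := odd_double_succ (odd_pow_l i).
  rewrite kE in s0E fE; rewrite kE.
  have := split_height c0 b0 d0 x0 yE rho0 rho_root h'E (esym s0E) fE ds0.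
  have := height_conj h'E.
  have h'0 : h' != 0 by have := mulf_neq0 b0 d0; rewrite -h'E expf_eq0.
  have EP := trace_conj_mul h'E yE; rewrite subrK -exprM in EP.
  have cx0 : c * x ^+ 4 != 0 by rewrite mulf_neq0 ?expf_neq0.
  have P0 : c + a * v + y * h' != 0.
    by apply: contraNneq cx0 => P0; rewrite -EP P0 mul0r.
  have P'0 : c + a * v - y * h' != 0.
    by apply: contraNneq cx0 => P'0; rewrite -EP P'0 mulr0.
  (* In heights, h(P) = h(c) + 4 h(x) - h(P') >= 2 h(x) - h(a). *)
  have := congr1 (@height F) EP.
  rewrite (heightM P0 P'0) (heightM c0 (expf_neq0 (2 * 2) x0)) heightX //.
  rewrite -!height_ord_inf; move: (height (_ + _ + _)) (height (_ + _ - _)).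
  move=> n1 n2; move: (_ * (_ - 4)) => w; clear; lia.
pose al' := io (a ^+ 2) / io c; pose om' := io v / io a.
have [i [i_le [[al alE] [om omE]] nP]] : exists i, [/\ (i <= e)%N,
    ppower i al' /\ ppower i om' & ~ (ppower i.+1 al' /\ ppower i.+1 om')].
  apply: (last_level (P := fun i => ppower i al' /\ ppower i om')).
    by split; apply: ppower0.
  by case=> h1 h2; have := insep h1 h2; rewrite ltnn.
exists i => //.
have fal : (al - 1) ^+ (l ^ i) = al ^+ (l ^ i) - 1 by rewrite pow_frobB expr1n.
have fom : (1 + om) ^+ (l ^ i) = 1 + om ^+ (l ^ i).
  by rewrite exprDn_pchar ?pchar_pow // expr1n.
have fnu : (al * om ^+ 2 - 1) ^+ (l ^ i) = (al * om ^+ 2) ^+ (l ^ i) - 1.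
  by rewrite pow_frobB expr1n.
suff th0 : tderiv (al * om ^+ 2) - tderiv al != 0.
  have [k kE] := odd_double_succ (odd_pow_l i).
  rewrite kE in alE omE fal fom fnu; rewrite kE.
  have := nonsplit_height c0 b0 d0 x0 yE rho0 rho_root a0 v0 y0 (esym alE)
    (esym omE) fal fom fnu th0.
  have := height_b; rewrite -!height_ord_inf; move: (_ * (_ - 4)) => w; clear; lia.
have q0 : (0 < l ^ i)%N by rewrite expn_gt0 prime_gt0 // (pcharf_prime charF).
have al'0 : al' != 0 by rewrite mulf_neq0 ?invr_neq0 ?io_eq0 ?expf_neq0.
have om'0 : om' != 0 by rewrite mulf_neq0 ?invr_neq0 ?io_eq0.
have al0 : al != 0.
  by apply: contraNneq al'0 => al0; rewrite alE al0 expr0n -(prednK q0).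
have om0 : om != 0.
  by apply: contraNneq om'0 => om0; rewrite omE om0 expr0n -(prednK q0).
have alq1 : (al - 1) ^+ (l ^ i) = io b / io c.
  by rewrite fal -alE /al' rmorphB; field; rewrite io_eq0.
have nuq1 : (al * om ^+ 2 - 1) ^+ (l ^ i) = io (d * y ^+ 2) / io c.
  rewrite fnu exprMn -exprM mulnC exprM -alE -omE /al' /om' yE.
  by rewrite !(rmorphB, rmorphXn) /=; field; rewrite !io_eq0 c0 a0.
have al10 : al - 1 != 0.
  apply/eqP=> E; move/eqP: alq1; rewrite E expr0n gtn_eqF // eq_sym.
  by rewrite mulf_eq0 invr_eq0 !io_eq0 (negPf b0) (negPf c0).
have nu10 : al * om ^+ 2 - 1 != 0.
  apply/eqP=> E; move/eqP: nuq1; rewrite E expr0n gtn_eqF // eq_sym.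
  by rewrite mulf_eq0 invr_eq0 !io_eq0 mulf_eq0 expf_eq0 (negPf d0) (negPf y0) (negPf c0).
have nu0 : al * om ^+ 2 != 0 by rewrite mulf_neq0 ?expf_neq0.
have d_nu : fder (al * om ^+ 2) =
    fder al * om ^+ 2 + 2%:R * (al * om) * fder om.
  by rewrite fderM expr2 fderM; ring.
apply/eqP=> /eqP; rewrite subr_eq0 => /eqP thE.
(* If al' = 0, then equality forces the derivative of al om^2, hence om', to vanish, and both
   quotients are powers one level higher. *)
have dal0 : fder al != 0.
  apply/eqP=> dal; apply: nP; rewrite alE omE; split; apply: ppower_step => //.
  have nn := mulf_neq0 nu0 nu10.
  have : fder (al * om ^+ 2) ^+ 2 = 0.
    by rewrite -[LHS](divfK nn) -/(tderiv _) thE /tderiv dal expr0n !mul0r.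
  move/eqP; rewrite expf_eq0 /= d_nu dal mul0r add0r.
  by rewrite mulf_eq0 (negPf (mulf_neq0 two_neq0 (mulf_neq0 al0 om0))) => /eqP.
(* With nu = al om^2, equality makes nu (nu - 1) al (al - 1) the square of z. Its l^i-th power is b
   d times a square, so b d would be a square. *)
pose z := fder (al * om ^+ 2) * (al * (al - 1)) / fder al.
have zE : al * om ^+ 2 * (al * om ^+ 2 - 1) * (al * (al - 1)) = z ^+ 2.
  have -> : z ^+ 2 = tderiv (al * om ^+ 2)
     * (al * om ^+ 2 * (al * om ^+ 2 - 1)) * (al * (al - 1)) ^+ 2 / fder al ^+ 2.
    by rewrite /tderiv /z; field; rewrite dal0 nu10 om0 al0.
  rewrite thE /tderiv; field; by rewrite dal0 al10.
have zq : (z ^+ (l ^ i)) ^+ 2 = io (a ^+ 2) / io c * (io v / io a) ^+ 2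
    * (io (d * y ^+ 2) / io c) * (io (a ^+ 2) / io c * (io b / io c)).
  rewrite -exprM mulnC exprM -zE !exprMn nuq1 alq1.
  by rewrite -alE -omE -exprMn.
have [|h hE] := @io_square (b * d)
  (z ^+ (l ^ i) * io (c ^+ 2) / io (v * y * a)); last by apply: nsq; exists h.
rewrite expr_div_n exprMn zq.
have V0 : io x ^+ 2 - io a != 0 by rewrite -rmorphXn -rmorphB io_eq0.
rewrite !(rmorphM, rmorphXn, rmorphB) /=; field.
by rewrite V0 !io_eq0 a0 c0 y0.
Qed.

End OrbitHeight.

(** * The dynamical inseparability degree *)

Lemma fder_pow_l f : fder (f ^+ l) = 0.
Proof.
have fderXS k : fder (f ^+ k.+1) = k.+1%:R * f ^+ k * fder f.
  elim: k => [|k IH]; first by rewrite expr1 expr0 !mul1r.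
  by rewrite exprS fderM IH -[k.+2%:R]natr1 [f ^+ k.+1]exprS; ring.
have l0 := prime_gt0 (pcharf_prime charF).
by rewrite -(prednK l0) fderXS prednK // (pcharf0 charK) !mul0r.
Qed.

(** T starts at -1 and follows T -> a T^2 - 1. That T is a polynomial in a is recorded only by a'
    dividing T'. *)
Lemma orbit_deriv (a : {poly F}) m (x := iter m (fun z => z ^+ 2 - a) (- a)) :
  exists T, [/\ x = a * T, exists S, T = -1 + a * S
             & exists Q, T^`() = a^`() * Q].
Proof.
rewrite {}/x; elim: m => [|m [T [/= -> _ [Q EQ]]]].
  exists (-1); split; first by rewrite mulrN1.
    by exists 0; rewrite mulr0 addr0.
  by exists 0; rewrite derivN -polyC1 derivC oppr0 mulr0.
exists (a * T ^+ 2 - 1); split; first by ring.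
  by exists (T ^+ 2); rewrite addrC.
exists (T ^+ 2 + 2%:R * a * T * Q).
rewrite derivB derivM -polyC1 derivC subr0 deriv_exp EQ -mulr_natr expr1 /=.
by ring.
Qed.

(* If a is constant times sqrt c1, then x = a T with T a polynomial in a and T = -1
   mod a; so the derivative of a T^2 is a' times a unit mod a, and a' = 0. *)
Lemma orbit_ppower i (a : {poly F}) m : (0 < height a)%N ->
  ppower i (io (iter m (fun z => z ^+ 2 - a) (- a) ^+ 2) / io a) ->
  ppower i (io a).
Proof.
elim: i a => [|i IH] a ha; first by move=> _; exact: ppower0.
have a0 : a != 0 by apply: contraTneq ha => ->; rewrite /height size_poly0.
have [T [xE [S TE] [Q EQ]]] := orbit_deriv a m.
move=> [g gE].
have PE : io (a * T ^+ 2) = g ^+ (l ^ i.+1).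
  by rewrite -gE xE !(rmorphXn, rmorphM); field; rewrite io_eq0.
have dP : (a * T ^+ 2)^`() = 0.
  by apply: io_inj; rewrite -fder_io PE expnSr exprM fder_pow_l rmorph0.
have da : a^`() = 0.
  have E : (a * T ^+ 2)^`() = a^`() * (T ^+ 2 + 2%:R * a * T * Q).
    by rewrite derivM deriv_exp EQ -mulr_natr expr1 /=; ring.
  move/eqP: dP; rewrite E mulf_eq0 => /orP[/eqP//|/eqP E0].
  have : a %| 1.
    (* The cofactor comes from squaring T = -1 + a S. *)
    have -> : 1 = a * (2%:R * S - a * S ^+ 2 - 2%:R * T * Q).
      have : T ^+ 2 + 2%:R * a * T * Q = 1 - a * (2%:R * S - a * S ^+ 2 - 2%:R * T * Q).
        by rewrite {1}TE; ring.
      by rewrite E0 => /esym/eqP; rewrite subr_eq0 => /eqP.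
    exact: dvdp_mulIl.
  by rewrite dvdp1 => /eqP sa; move: ha; rewrite /height sa.
have [a1 a1E] := deriv0_pth_power da.
have charP : l \in [pchar {poly F}] by rewrite (rmorph_pchar polyC).
(* Frobenius commutes with the recursion, so the orbit of a = a1^l is the l-th power of that of a1;
   l-th roots of the hypothesis then allow induction. *)
have xE1 : iter m (fun z => z ^+ 2 - a) (- a) =
    iter m (fun z => z ^+ 2 - a1) (- a1) ^+ l.
  rewrite a1E; clear -charP; elim: m => [|m /= ->].
    by rewrite /= -!(pFrobenius_autE charP) rmorphN.
  by rewrite -!(pFrobenius_autE charP) rmorphB rmorphXn.
have ha1 : (0 < height a1)%N.
  by case: posnP => // h1; move: ha; rewrite a1E heightX h1 muln0.
have : ppower i (io a1).
  apply: IH => //; exists g; apply: (@pow_frob_inj 1); rewrite expn1.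
  rewrite -[RHS]exprM -expnSr -gE xE1 expr_div_n -!rmorphXn /=.
  by rewrite -!exprM mulnC -a1E.
by move=> [h hE]; exists h; rewrite a1E rmorphXn hE -exprM -expnSr.
Qed.

Section DynamicalLevel.

Variables (L : fieldType) (iota : {rmorphism K -> L}).
Variables (gamma c : {poly F}) (g : {poly F}) (s : L).
Local Notation a := (gamma + c).
Hypotheses (c0 : c != 0) (gE : c = g ^+ 2) (sE : s ^+ 2 = iota (io c)).

Let g0 : g != 0.
Proof. by move: c0; rewrite gE expf_eq0. Qed.

(** As s^2 = c = g^2 in L, s is g or - g, and gamma / s + s = (gamma + c) / s. *)
Lemma invariant_sqrt : exists2 g', g' = g \/ g' = - g &
  iota (io gamma) / s + s = iota (io a / io g').
Proof.
have s0 : s != 0.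
  have : s ^+ 2 != 0 by rewrite sE fmorph_eq0 io_eq0.
  by rewrite expf_eq0.
have Es : iota (io gamma) / s + s = iota (io a) / s.
  by rewrite !rmorphD mulrDl -sE expr2 mulfK.
have : (s == iota (io g)) || (s == - iota (io g)).
  by rewrite -eqf_sqr sE gE !rmorphXn.
case/orP=> /eqP E; [exists g | exists (- g)]; auto.
  by rewrite Es E -fmorph_div.
by rewrite Es E -!rmorphN -fmorph_div.
Qed.

Lemma invariant_ppower i : ppower i (io (a ^+ 2) / io c) ->
  exists z, iota (io gamma) / s + s = iota z ^+ (l ^ i).
Proof.
have [g' g'E ->] := invariant_sqrt => hal.
have : ppower i (io a / io g').
  apply: ppower_sqrt; rewrite expr_div_n -!rmorphXn.
  by have -> : g' ^+ 2 = c by rewrite gE; case: g'E => ->; rewrite ?sqrrN.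
by move=> [z ->]; exists z; rewrite rmorphXn.
Qed.

(** If a / g' is the constant u, then c = (a / u)^2 and a^2 / c is constant, so the level is read
    off from v / a instead: x^2 / a = 1 + v / a and [orbit_ppower] make a an l^i-th power. *)
Lemma c_ppower i m (x := iter m (fun z => z ^+ 2 - a) (- a)) (u : F) :
  (0 < height a)%N -> iota (io gamma) / s + s = iota (io u%:P) ->
  ppower i (io (x ^+ 2 - a) / io a) ->
  exists z, iota (io c) = iota z ^+ (l ^ i).
Proof.
move=> ha; have [g' g'E ->] := invariant_sqrt => /fmorph_inj Eu hom.
have a0 : a != 0 by apply: contraTneq ha => ->; rewrite /height size_poly0.
have g'0 : g' != 0 by case: g'E => ->; rewrite ?oppr_eq0.
have g'c : c = g' ^+ 2 by rewrite gE; case: g'E => ->; rewrite ?sqrrN.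
have : ppower i (io a).
  apply: (@orbit_ppower _ _ m) => //; rewrite -/x.
  have -> : io (x ^+ 2) / io a = 1 + io (x ^+ 2 - a) / io a.
    by rewrite rmorphB mulrBl divff ?io_eq0 // addrCA subrr addr0.
  by apply: ppowerD => //; exact: ppower1.
move=> hap; have : ppower i (io c).
  have -> : io c = (io a / io u%:P) ^+ 2.
    by rewrite -Eu invf_div mulrC divfK ?io_eq0 // -rmorphXn -g'c.
  by apply: ppowerX; apply: ppowerM => //; apply: ppowerV; exact: ppower_const.
by move=> [z ->]; exists z; rewrite rmorphXn.
Qed.

End DynamicalLevel.

End RationalFunctions.

(** * Radicals and the shifted post-critical orbit *)

Lemma is_rad_root (F : fieldType) (f r : {poly F}) : f != 0 -> is_rad f r ->
  r != 0 /\ forall t, root f t -> root r t.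
Proof.
move=> f0 [s [_ sP ->]]; split.
  rewrite monic_neq0 // big_seq; apply: monic_prod => q.
  by case/sP.
move=> t ft; have : 'X - t%:P \in s.
  apply/sP; split; first exact: monicXsubC.
    exact: irredp_XsubC.
  by rewrite -root_factor_theorem.
move=> /(big_rem _) -> /=.
by rewrite rootM root_XsubC eqxx.
Qed.

Section PostcriticalOrbit.

Variables (F : fieldType) (gamma c1 : {poly F}).

(* The value c_m - gamma of the orbit, shifted so that phi becomes
   z |-> z^2 - (gamma + c1). *)
Definition shifted_orbit m : {poly F} :=
  iter m (fun z => z ^+ 2 - (gamma + c1)) (- (gamma + c1)).

Lemma iter_phi m :
  iter m.+1 (horner (phi gamma c1)) gamma = shifted_orbit m + gamma.
Proof.
have phiE z : (phi gamma c1).[z + gamma] = z ^+ 2 - c1.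
  by rewrite /phi !hornerE addrK.
elim: m => [|m IH].
  by rewrite /= -[X in _.[X]]add0r phiE expr0n sub0r opprD addrC addNKr.
by rewrite iterS IH phiE /=; ring.
Qed.

Lemma postcritSS m : postcrit gamma c1 m.+2 = shifted_orbit m ^+ 2 - c1.
Proof.
rewrite /postcrit /= -[LHS]/(horner _ (iter m.+1 _ gamma)) iter_phi.
by rewrite /phi !hornerE addrK.
Qed.

Lemma height_shifted_orbit m : (0 < height (gamma + c1))%N ->
  height (shifted_orbit m) = (height (gamma + c1) * 2 ^ m)%N.
Proof.
move=> h; elim: m => [|m IH]; first by rewrite muln1 heightN.
have p2 : (0 < 2 ^ m)%N by rewrite expn_gt0.
have -> : shifted_orbit m.+1 = shifted_orbit m ^+ 2 - (gamma + c1) by [].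
have hsq : height (shifted_orbit m ^+ 2) = (height (gamma + c1) * 2 ^ m.+1)%N.
  by rewrite heightX IH expnS mulnCA.
rewrite (@heightD_dominant _ (shifted_orbit m ^+ 2)) ?hsq // heightN.
by rewrite expnS mulnCA mul2n -addnn -addn1 leq_add ?muln_gt0 ?h // leq_pmulr.
Qed.

End PostcriticalOrbit.

(* F with j is an algebraic closure of 'F_p; s is the fixed square root of c1,
   taken in a field L that extends F(t). *)
Theorem theorem2p6
  (p : nat) (p_prime : prime p) (p_odd : odd p)
  (F : closedFieldType) (j : {rmorphism 'F_p -> F}) (j_alg : integralRange j)
  (L : fieldType) (iota : {rmorphism {fraction {poly F}} -> L})
  (gamma c1 : {poly F})
  (s : L) (s_sqrt : s ^+ 2 = embed iota c1)
  (nonisotrivial : (0 < height (gamma + c1))%N)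
  (nonsquare : c1 != 0)
  (e : nat) (he : dyn_insep_degree iota p gamma c1 s e)
  (h_plus : embed iota (c1 + gamma) + s != 0)
  (h_minus : embed iota (c1 + gamma) - s != 0)
  (n : nat) (n_ge3 : (3 <= n)%N)
  (n_large :
    (height_phi gamma c1 < height (gamma + c1)%R * 2 ^ (n - 3))%N)
  (d y : nat -> {poly F})
  (d_sqfree : forall m, (1 <= m)%N -> squarefree_poly (d m))
  (dy_eq : forall m, (1 <= m)%N -> postcrit gamma c1 m = d m * y m ^+ 2)
  (r1 r2 : {poly F})
  (r1_rad : is_rad (postcrit gamma c1 1) r1)
  (r2_rad : is_rad (postcrit gamma c1 2) r2) :
  let A := (8 * p ^ e)%N in
  let B := (8 * p ^ e * (height (d 1%N) + 4 + 4 * height r1 + 4 * height r2)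
            + 4 * height gamma + 8 * height c1)%N in
  (height (postcrit gamma c1 (n - 1)) <= A * height (d n) + B)%N.
Proof.
set a : {poly F} := gamma + c1; pose io : {rmorphism {poly F} -> {fraction {poly F}}} :=
  @tofrac {poly F}.
have io_inj : injective io by move=> u w /eqP; rewrite tofrac_eq => /eqP.
have io_quo := @fraction_quotient {poly F}.
have charF : p \in [pchar F] by rewrite (rmorph_pchar j) // pchar_Fp.
case: n n_ge3 n_large => [|[|[|k]]] // _; rewrite -{1}[k.+3]addn3 addnK.
move=> k_large; cbv zeta.
have a0 : a != 0.
  by apply: contraTneq nonisotrivial => a0; rewrite -/a a0 /height size_poly0.
pose x := shifted_orbit gamma c1 k.
have hx : height x = (height a * 2 ^ k)%N by apply: height_shifted_orbit.
(* For n = k + 3, the hypothesis on n says that gamma and c1 have smaller height than x. *)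
rewrite -hx gtn_max in k_large; have /andP[gamma_x c_x] := k_large.
have a_x : (height a < height x)%N.
  apply: leq_ltn_trans (_ : maxn (height gamma) (height c1) < _)%N.
    by apply: heightD_le; rewrite ?leq_maxl ?leq_maxr.
  by rewrite gtn_max gamma_x.
have ha : (height a <= height gamma + height c1)%N.
  by apply: heightD_le; rewrite ?leq_addr ?leq_addl.
have x0 : x != 0 by apply: contraTneq a_x => ->; rewrite /height size_poly0.
(* a^2 - c1 = (a - s)(a + s) is nonzero by the hypotheses for both signs. *)
have b0 : a ^+ 2 - c1 != 0.
  have : embed iota (a ^+ 2 - c1) != 0.
    have -> : embed iota (a ^+ 2 - c1) =
        (embed iota (c1 + gamma) - s) * (embed iota (c1 + gamma) + s).
      by rewrite -subr_sqr s_sqrt /embed [c1 + gamma]addrC !(rmorphB, rmorphXn).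
    exact: mulf_neq0.
  by apply: contraNneq => ->; rewrite /embed !rmorph0.
have c2E : postcrit gamma c1 2 = a ^+ 2 - c1 by rewrite postcritSS sqrrN.
have hv : height (x ^+ 2 - a) = (2 * height x)%N.
  by rewrite heightD_dominant heightX // heightN mul2n -addnn ltn_addl.
have v0 : x ^+ 2 - a != 0.
  apply: contraTneq a_x => v0; move: hv; rewrite v0 /height size_poly0 /=.
  by case: (size x).-1.
have cn : postcrit gamma c1 k.+3 = (x ^+ 2 - a) ^+ 2 - c1 by rewrite postcritSS.
have cn0 : (x ^+ 2 - a) ^+ 2 - c1 != 0.
  have : (0 < height ((x ^+ 2 - a) ^+ 2 - c1))%N.
    rewrite heightD_dominant heightX hv ?heightN.
      by rewrite !muln_gt0 /=; apply: leq_ltn_trans a_x.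
    by apply: leq_trans c_x _; rewrite mulnA leq_pmull.
  by apply: contraTneq => ->; rewrite /height size_poly0.
have yE : d k.+3 * y k.+3 ^+ 2 = (x ^+ 2 - a) ^+ 2 - c1 by rewrite -dy_eq.
have d0 : d k.+3 != 0 by apply: contraNneq cn0 => d0; rewrite -yE d0 mul0r.
have y0 : y k.+3 != 0.
  by apply: contraNneq cn0 => y0; rewrite -yE y0 expr0n mulr0.
rewrite postcrit1 in r1_rad; rewrite c2E in r2_rad.
have [r10 r1_root] := is_rad_root nonsquare r1_rad.
have [r20 r2_root] := is_rad_root b0 r2_rad.
have rho_root t : root ((a ^+ 2 - c1) * c1) t -> root (r1 * r2) t.
  rewrite !rootM => /orP[/r2_root ->|/r1_root ->] //; exact: orbT.
(* The three cases define e by different functions; in the first, c_2 / c1 = a^2 / c1 - 1. *)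
have insep i : ppower p i (io (a ^+ 2) / io c1) ->
    ppower p i (io (x ^+ 2 - a) / io a) -> (i <= e)%N.
  move=> hal hom; case: he => [_ [_ emax]|[g gE] _ [_ emax]|[g gE] [u uE] [_ emax]].
  - apply: emax; rewrite c2E.
    have : ppower p i (io (a ^+ 2 - c1) / io c1).
      rewrite rmorphB mulrBl divff ?tofrac_eq0 //.
      by apply: (ppowerB io charF hal); exact: ppower1.
    by move=> [z zE]; exists z; rewrite /embed -fmorph_div -rmorphXn -zE.
  - apply: emax.
    exact: (invariant_ppower io_inj p_odd nonsquare gE s_sqrt hal).
  - apply: emax.
    exact: (c_ppower (m := k) io_inj io_quo charF nonsquare gE s_sqrt
      nonisotrivial uE hom).
have := orbit_height io_inj io_quo charF p_odd a0 nonsquare b0 d0 x0 y0 v0 yE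
  (mulf_neq0 r10 r20) rho_root insep a_x c_x.
(* c_(n-1) = x^2 - c1 has exactly the height 2 h(x) that has been bounded. *)
have hcn : height (x ^+ 2 - c1) = (2 * height x)%N.
  rewrite (@heightD_dominant _ (x ^+ 2)) heightX // heightN.
  by apply: leq_trans c_x _; rewrite leq_pmull.
rewrite heightM // subn1 /= postcritSS -/x hcn.
(* With h(a) <= h(gamma) + h(c1), the bound is p^e (4 h(r1 r2) + 2 h(d_n)) + 3 h(gamma) + 4 h(c1),
   within the stated one. *)
move: ha; move: (p ^ e)%N; clear=> E ha h.
by apply: leq_trans h _; nia.
Qed.
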